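(* The following conditions are equivalent. (i) $\operatorname{Ker}_h(\Delta_\Gamma)=\operatorname{span}\{1\}$, where $\operatorname{Ker}_h(\Delta_\Gamma)=\{\hat w_h\in W_h: a(\hat w_h,\hat v_h)=0\ \ \forall\hat v_h\in W_h\}$. (ii) $\operatorname{E}(0)=\{0\}$, where $\operatorname{E}(0)=\{\hat v_h\in W_h:\hat v_h|_\Gamma=0\}$. (iii) $\Gamma$ is not a part of (i.e. not contained in) the zero level set of any non-zero finite element function in $W_h$. (iv) $\dim(W_h)=\dim(V_h)$.
   Context: Setting: $\Gamma$ is a closed (compact, without boundary), connected, smooth surface contained in a bounded domain $\Omega\subset\mathbb{R}^3$, and $\mathcal{T}_h$ is a shape-regular tetrahedral partition of $\Omega$. For $T\in\mathcal{T}_h$ put $F_T=T\cap\Gamma$, and let $\mathcal{T}_h^\Gamma=\{T\in\mathcal{T}_h: \operatorname{meas}_2(F_T)\ne 0\}$ (if $F_T$ lies on the common face of two neighbouring tetrahedra, only one of them is kept in $\mathcal{T}_h^\Gamma$). Let $\omega_h=\bigcup_{T\in\mathcal{T}_h^\Gamma}T$. For a fixed integer $k\ge1$, $W_h=\{\hat v_h\in C(\omega_h): \hat v_h|_T\in P_k(T)\ \forall T\in\mathcal{T}_h^\Gamma\}$, where $P_k(T)$ is the space of polynomials of degree at most $k$ on $T$, and $V_h=\{\hat v_h|_\Gamma:\hat v_h\in W_h\}$ is the space of traces on $\Gamma$. Bilinear form: $a(u,v)=\int_\Gamma\nabla_\Gamma u\cdot\nabla_\Gamma v\,\mathrm{d}s$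 with $\nabla_\Gamma$ the surface gradient; applied to functions in $W_h$ it is evaluated on the traces on $\Gamma$. *)

(* Defs.v *)
From HB Require Import structures.
From mathcomp Require Import all_boot all_order all_algebra.
From mathcomp Require Import all_classical all_reals all_analysis.
Set Implicit Arguments.
Unset Strict Implicit.
Unset Printing Implicit Defensive.
Import Order.TTheory GRing.Theory Num.Theory.
Import numFieldNormedType.Exports.
Local Open Scope classical_set_scope.
Local Open Scope ring_scope.

Section euclidean.
Variables (R : realType) (n : nat).
Implicit Types x y : 'rV[R]_n.

(* The library norm on row vectors is the sup norm; it induces the same
   topology as the Euclidean norm, but areas and gradients need the latter. *)
Definition dot x y : R := \sum_i x 0 i * y 0 i.
Definition enorm x : R := Num.sqrt (dot x x).

(* Adjoining 0 makes the diameter of the empty set 0 instead of -oo. *)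
Definition diam (A : set 'rV[R]_n) : \bar R :=
  ereal_sup (0%E |` [set (enorm (p.1 - p.2))%:E | p in A `*` A]).

Lemma diam_ge0 A : (0 <= diam A)%E.
Proof. by apply: ereal_sup_ubound; left. Qed.

Lemma diam0 : diam set0 = 0%E.
Proof.
apply/eqP; rewrite eq_le diam_ge0 andbT; by apply: ge_ereal_sup => _ [->//|[p [[]]]].
Qed.
End euclidean.

Section hausdorff.
Variable R : realType.
Local Open Scope ereal_scope.
Implicit Types (A : set 'rV[R]_3) (C : (set 'rV[R]_3)^nat) (d : R).

Definition hausdorff2_cover d A : set ((set 'rV[R]_3)^nat) :=
  [set C | A `<=` \bigcup_i C i /\ forall i, diam (C i) <= d%:E].

(* The factor pi / 4 makes the two-dimensional Hausdorff measure agree with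
   surface area. *)
Definition hausdorff2_weight (B : set 'rV[R]_3) : \bar R :=
  (pi / 4)%:E * (diam B * diam B).

Definition hausdorff2_pre d A : \bar R :=
  ereal_inf [set \sum_(i <oo) hausdorff2_weight (C i) |
             C in hausdorff2_cover d A].

Definition hausdorff2 A : \bar R :=
  ereal_sup [set hausdorff2_pre d A | d in [set d | (0 < d)%R]].

Lemma hausdorff2_weight_ge0 B : 0 <= hausdorff2_weight B.
Proof.
rewrite /hausdorff2_weight mule_ge0 ?mule_ge0 ?diam_ge0// lee_fin.
by rewrite divr_ge0 ?pi_ge0.
Qed.

Lemma hausdorff2_pre_ge0 d A : 0 <= hausdorff2_pre d A.
Proof.
apply: le_ereal_inf_tmp => _ [C _ <-].
by apply: nneseries_ge0 => i _ _; exact: hausdorff2_weight_ge0.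
Qed.

Lemma hausdorff2_ge0 A : 0 <= hausdorff2 A.
Proof.
apply: (le_trans (hausdorff2_pre_ge0 1 A)).
by apply: ereal_sup_ubound; exists 1%R => //=.
Qed.

Lemma hausdorff2_set0 : hausdorff2 set0 = 0.
Proof.
apply/eqP; rewrite eq_le hausdorff2_ge0 andbT.
apply: ge_ereal_sup => _ [d d0 <-]; apply: ereal_inf_lbound.
exists (fun=> set0).
  by split=> [x []//|i]; rewrite diam0 lee_fin ltW.
by apply: eseries0 => i _ _; rewrite /hausdorff2_weight diam0 !mule0.
Qed.

Lemma le_hausdorff2 : {homo hausdorff2 : A B / A `<=` B >-> A <= B}.
Proof.
move=> A B AB; apply: ge_ereal_sup => _ [d d0 <-].
apply: (@le_trans _ _ (hausdorff2_pre d B)); last first.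
  by apply: ereal_sup_ubound; exists d.
apply: le_ereal_inf => _ [C [BC dC] <-]; exists C => //; split=> //.
exact: subset_trans BC.
Qed.

Lemma hausdorff2_pre_sigma_subadditive d :
  sigma_subadditive (hausdorff2_pre d).
Proof.
move=> A; set mu := hausdorff2_pre d.
have [[i ioo]|] := pselect (exists i, mu (A i) = +oo).
  rewrite (eseries_pinfty _ _ ioo) ?leey// => n _.
  by rewrite -ltNye (lt_le_trans _ (hausdorff2_pre_ge0 _ _)).
rewrite -forallNE => Aoo.
apply/lee_addgt0Pr => e e0.
rewrite (le_trans _ (epsilon_trick _ _ (ltW e0)))//; last first.
  by move=> n; exact: hausdorff2_pre_ge0.
pose P n C := hausdorff2_cover d (A n) C /\
  \sum_(k <oo) hausdorff2_weight (C k) <= mu (A n) + (e / (2 ^ n.+1)%:R)%:E.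
have [G PG] : {G : ((set 'rV[R]_3)^nat)^nat & forall n, P n (G n)}.
  apply: (@choice _ _ P) => n.
  have fin : mu (A n) \is a fin_num.
    by rewrite ge0_fin_numE ?hausdorff2_pre_ge0// ltey; exact/eqP.
  have en : (0 < e / (2 ^ n.+1)%:R)%R by rewrite divr_gt0// ltr0n expn_gt0.
  have [_ [C AC <-] /ltW leC] := lb_ereal_inf_adherent en fin.
  by exists C.
pose w (p : nat * nat) := hausdorff2_weight (G p.1 p.2).
have w0 p : 0 <= w p by exact: hausdorff2_weight_ge0.
apply: (@le_trans _ _ (\esum_(p in setT) w p)).
  have /card_esym/ppcard_eqP[f] := card_nat2.
  apply: ereal_inf_lbound; exists (fun i => G (f i).1 (f i).2).
    split=> [x [n _ Anx]|i]; last by case: (PG (f i).1) => -[_ dG] _; exact: dG.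
    have [[AG _] _] := PG n; have [k _ Gx] := AG _ Anx.
    by exists (f^-1%FUN (n, k)) => //=; rewrite invK ?inE.
  rewrite nneseries_esumT; last by move=> i; exact: (w0 (f i)).
  by rewrite (reindex_esum setT setT f).
rewrite (_ : esum _ _ = \sum_(i <oo) \sum_(j <oo) w (i, j)); last first.
  rewrite nneseries_esumT; last by move=> i; apply: nneseries_ge0 => j _ _.
  rewrite (_ : setT = setT `*`` (fun=> setT)); last first.
    by apply/seteqP; split.
  rewrite -(@esum_esum _ _ _ setT (fun=> setT) (fun i j => w (i, j)))//.
  by apply: eq_esum => i _; rewrite nneseries_esumT.
apply: lee_nneseries => [i _ _|i _]; first by apply: nneseries_ge0 => j _ _.
by case: (PG i).
Qed.

Lemma hausdorff2_sigma_subadditive : sigma_subadditive hausdorff2.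
Proof.
move=> A; apply: ge_ereal_sup => _ [d d0 <-].
apply: (le_trans (hausdorff2_pre_sigma_subadditive _ _)).
apply: lee_nneseries => [i _ _|i _]; first exact: hausdorff2_pre_ge0.
by apply: ereal_sup_ubound; exists d.
Qed.

HB.instance Definition _ := isOuterMeasure.Build R 'rV[R]_3 hausdorff2
  hausdorff2_set0 hausdorff2_ge0 le_hausdorff2 hausdorff2_sigma_subadditive.

(* Surface area, as a measure on the Caratheodory measurable sets. *)
Definition area : {measure set (caratheodory_type hausdorff2) -> \bar R} :=
  (hausdorff2 : {outer_measure set 'rV[R]_3 -> \bar R})
    : set (caratheodory_type hausdorff2) -> \bar R.
End hausdorff.

Section surface.
Variable R : realType.
Implicit Types (Gamma : set 'rV[R]_3) (u v : 'rV[R]_3 -> R).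

Fixpoint Cn (m n : nat) (D : set 'rV[R]_m.+1) (g : 'rV[R]_m.+1 -> R) : Prop :=
  (forall x, D x -> {for x, continuous g}) /\
  if n is n'.+1 then
    forall i, (forall x, D x -> derivable g x (delta_mx 0 i)) /\
              Cn n' D ('D_(delta_mx 0 i) g)
  else True.

Definition smooth (m : nat) (D : set 'rV[R]_m.+1) g := forall n, Cn n D g.

(* Near each of its points, Gamma is the graph of a smooth function expressing
   one of the three coordinates in terms of the other two. *)
Definition locally_smooth_graph Gamma :=
  forall p, Gamma p ->
  exists (j : 'I_3) (U : set 'rV[R]_3) (D : set 'rV[R]_2) (g : 'rV[R]_2 -> R),
    [/\ open U, U p, open D, smooth D g &
        Gamma `&` U = [set y | D (col' j y) /\ y 0 j = g (col' j y)]].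

Record closed_smooth_surface Gamma : Prop := ClosedSmoothSurface {
  surface_nonempty : Gamma !=set0;
  surface_compact : compact Gamma;
  surface_connected : connected Gamma;
  surface_smooth : locally_smooth_graph Gamma }.

Definition tangent Gamma x : set 'rV[R]_3 :=
  [set tau | exists gamma : R -> 'rV[R]_3,
    [/\ gamma 0 = x, \forall t \near (0 : R), Gamma (gamma t) &
        is_derive (0 : R) (1 : R) gamma tau]].

(* First-order expansion along Gamma only: this depends on nothing but the
   restriction of u to Gamma. *)
Definition is_surface_grad Gamma u x (g : 'rV[R]_3) :=
  tangent Gamma x g /\
  forall e : R, 0 < e -> \forall y \near within Gamma (nbhs x),
    `|u y - u x - dot g (y - x)| <= e * enorm (y - x).

(* Traces of finite element functions have a surface gradient almost
   everywhere on Gamma; 0 is the value where there is none. *)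
Definition surface_grad Gamma u x : 'rV[R]_3 :=
  xget 0 [set g | is_surface_grad Gamma u x g].

Definition dirichlet_form Gamma u v : \bar R :=
  (\int[@area R]_(x in Gamma)
    (dot (surface_grad Gamma u x) (surface_grad Gamma v x))%:E)%E.
End surface.

Section mesh.
Variable R : realType.

(* The rows of P are the vertices; L selects the vertices of the face. *)
Definition face (P : 'M[R]_(4, 3)) (L : set 'I_4) : set 'rV[R]_3 :=
  [set x | exists a : 'rV[R]_4,
    [/\ forall l, 0 <= a 0 l, forall l, ~ L l -> a 0 l = 0,
        \sum_l a 0 l = 1 & x = a *m P]].

Definition tetra (P : 'M[R]_(4, 3)) : set 'rV[R]_3 := face P setT.

Definition affinely_independent (P : 'M[R]_(4, 3)) :=
  row_free (row_mx P (const_mx 1 : 'cV[R]_4)).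

Definition eball (c : 'rV[R]_3) (r : R) : set 'rV[R]_3 :=
  [set x | enorm (x - c) <= r].

Record bounded_domain (Omega : set 'rV[R]_3) : Prop := BoundedDomain {
  domain_nonempty : Omega !=set0;
  domain_open : open Omega;
  domain_connected : connected Omega;
  domain_bounded : bounded_set Omega }.

(* In partition_conforming, the faces are of any dimension from -1 (the empty
   face) to 2; as they are proper, distinct indices give distinct tetrahedra. *)
Record tetra_partition (Omega : set 'rV[R]_3) (kappa : R)
    (I : finType) (V : I -> 'M[R]_(4, 3)) : Prop := TetraPartition {
  partition_nondegenerate : forall i, affinely_independent (V i);
  partition_cover : \bigcup_i tetra (V i) = closure Omega;
  partition_conforming : forall i j, i != j ->
    exists L L' : set 'I_4, [/\ L <> setT, L' <> setT,
      tetra (V i) `&` tetra (V j) = face (V i) L &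
      tetra (V i) `&` tetra (V j) = face (V j) L'];
  partition_shape_regular : forall i, exists (c : 'rV[R]_3) (r : R),
    [/\ 0 < r, eball c r `<=` tetra (V i) &
        (diam (tetra (V i)) <= (kappa * r)%:E)%E] }.

Section active.
Variables (Gamma : set 'rV[R]_3) (I : finType) (V : I -> 'M[R]_(4, 3)).

Definition cut (i : I) : set 'rV[R]_3 := tetra (V i) `&` Gamma.

Definition neighbours (i j : I) :=
  i != j /\
  exists l : 'I_4, tetra (V i) `&` tetra (V j) = face (V i) [set~ l].

Definition cut_on_common_face (i j : I) :=
  neighbours i j /\ cut i `<=` tetra (V i) `&` tetra (V j).

(* An index that meets Gamma in positive area is dropped only if its cut lies
   on the common face with a neighbour which is kept, and such a tetrahedron is
   never kept along with that neighbour. The selection is in general not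
   unique. *)
Record active_selection (A : set I) : Prop := ActiveSelection {
  active_area : forall i, A i -> area R (cut i) <> 0%E;
  active_dropped : forall i, ~ A i -> area R (cut i) <> 0%E ->
    exists2 j, A j & cut_on_common_face i j;
  active_single : forall i j, A i -> A j -> ~ cut_on_common_face i j }.
End active.

Section spaces.
Variables (I : finType) (V : I -> 'M[R]_(4, 3)) (A : set I) (k : nat).

Definition active_domain : set 'rV[R]_3 := \bigcup_(i in A) tetra (V i).

(* The polynomial of total degree at most k whose coefficient at the monomial
   with exponents m is c m. *)
Definition poly3 (c : {ffun 'I_3 -> 'I_k.+1} -> R) (x : 'rV[R]_3) : R :=
  \sum_(m : {ffun 'I_3 -> 'I_k.+1} | (\sum_j m j <= k)%N)
    c m * \prod_j x 0 j ^+ m j.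

(* Functions on the active domain are represented by their extension by 0, so
   that equality of representatives is equality on the domain. *)
Definition fe_space : set ('rV[R]_3 -> R) :=
  [set v | [/\ {within active_domain, continuous v},
    forall i, A i -> exists c : {ffun 'I_3 -> 'I_k.+1} -> R,
      forall x, tetra (V i) x -> v x = poly3 c x &
    forall x, ~ active_domain x -> v x = 0]].

Definition trace (Gamma : set 'rV[R]_3) (v : 'rV[R]_3 -> R) := v \_ Gamma.

Lemma traceE Gamma v x : trace Gamma v x = if x \in Gamma then v x else 0.
Proof. by []. Qed.

Definition trace_space Gamma : set ('rV[R]_3 -> R) :=
  [set trace Gamma v | v in fe_space].

Definition fe_one : 'rV[R]_3 -> R := \1_active_domain.

Definition Ker_h Gamma : set ('rV[R]_3 -> R) :=
  [set w | fe_space w /\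
           forall v, fe_space v -> dirichlet_form Gamma w v = 0%E].

Definition E0 Gamma : set ('rV[R]_3 -> R) :=
  [set v | fe_space v /\ trace Gamma v = (fun=> 0)].

Definition zero_level (w : 'rV[R]_3 -> R) : set 'rV[R]_3 :=
  [set x | active_domain x /\ w x = 0].
End spaces.
End mesh.

Definition span1 (R : realType) (T : Type) (f : T -> R) : set (T -> R) :=
  [set (fun x => c * f x) | c in [set: R]].

Definition has_dim (R : realType) (T : Type) (W : set (T -> R)) (n : nat) :=
  exists b : 'I_n -> T -> R,
    [/\ forall i, W (b i),
        forall c : 'I_n -> R, (forall x, \sum_i c i * b i x = 0) ->
          forall i, c i = 0 &
        forall f, W f -> exists c : 'I_n -> R,
          forall x, f x = \sum_i c i * b i x].

(* Main.v *)
(* The only delicate implication is that w in Ker_h is constant on Gamma.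
   Testing with w itself, its energy vanishes. In a chart, w is a continuous
   selection of finitely many C^1 functions, the pullbacks of the polynomials on
   the tetrahedra. If one of them had a nonzero gradient at a point of an open
   set where it agrees with w, then the surface gradient of w would be bounded
   away from 0 on a closed piece of Gamma of positive area, contradicting zero
   energy; working with such a piece avoids the measurability of the gradient.
   Hence every piece is stationary where it agrees with w on an open set, and
   since near each point w only takes the values of pieces that agree with it on
   open sets accumulating there, w has zero derivative everywhere: it is locally
   constant, hence constant as Gamma is connected.

   Gamma is covered by the active tetrahedra because every nonempty relatively
   open part of Gamma has positive area, its projection along an axis containing
   a square. So E(0) is the kernel of the trace map, which gives the other
   implications by linear algebra. *)
Require Import Defs.
From HB Require Import structures.
From mathcomp Require Import all_boot all_order all_algebra.
From mathcomp Require Import all_classical all_reals all_analysis.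
From mathcomp Require Import ring lra.
Set Implicit Arguments.
Unset Strict Implicit.
Unset Printing Implicit Defensive.
Import Order.TTheory GRing.Theory Num.Theory.
Import numFieldNormedType.Exports.
Local Open Scope classical_set_scope.
Local Open Scope ring_scope.

(** * Finite-dimensional spaces of functions *)

Section function_spaces.
Variables (R : realType) (T : Type).
Implicit Types (W : set (T -> R)) (f : T -> R).

Definition independent n (b : 'I_n -> T -> R) :=
  forall c : 'I_n -> R, (forall x, \sum_i c i * b i x = 0) ->
    forall i, c i = 0.

Definition spanned (J : finType) (b : J -> T -> R) f :=
  exists c : J -> R, forall x, f x = \sum_i c i * b i x.

Definition lin_closed W :=
  forall n (b : 'I_n -> T -> R) (c : 'I_n -> R),
    (forall i, W (b i)) -> W (fun x => \sum_i c i * b i x).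

(** Once spanning is a matrix acting on rows of coefficients, rank arguments apply to families of
    functions. *)
Lemma spanned_matrix n N (b : 'I_n -> T -> R) (f : 'I_N -> T -> R) :
  (forall i, spanned f (b i)) -> exists M : 'M[R]_(n, N),
    forall (u : 'rV[R]_n) x,
      \sum_i u 0 i * b i x = \sum_j (u *m M) 0 j * f j x.
Proof.
move=> /choice[C bC]; exists (\matrix_(i, j) C i j) => u x.
under eq_bigr => i _ do rewrite bC mulr_sumr.
rewrite exchange_big; apply: eq_bigr => j _ /=.
by rewrite mxE mulr_suml; apply: eq_bigr => i _; rewrite mxE mulrA.
Qed.

Lemma independent_row n (b : 'I_n -> T -> R) (u : 'rV[R]_n) :
  independent b -> (forall x, \sum_i u 0 i * b i x = 0) -> u = 0.
Proof. by move=> bI /bI u0; apply/rowP => i; rewrite mxE u0. Qed.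

(** A row in the kernel of [M] gives a vanishing combination of the functions [b i], so it is
    zero. *)
Lemma row_free_independent n N (b : 'I_n -> T -> R) (f : 'I_N -> T -> R)
    (M : 'M[R]_(n, N)) : independent b ->
  (forall (u : 'rV[R]_n) x,
    \sum_i u 0 i * b i x = \sum_j (u *m M) 0 j * f j x) ->
  row_free M.
Proof.
move=> bI bM; rewrite -kermx_eq0; apply/eqP/row_matrixP => i; rewrite row0.
apply: (independent_row bI) => x; rewrite bM.
have /sub_kermxP -> : (row i (kermx M) <= kermx M)%MS by exact: row_sub.
by apply: big1 => j _; rewrite mxE mul0r.
Qed.

Lemma independent_le n N (b : 'I_n -> T -> R) (f : 'I_N -> T -> R) :
  independent b -> (forall i, spanned f (b i)) -> (n <= N)%N.
Proof.
move=> bI /spanned_matrix[M bM].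
by have /eqP <- := row_free_independent bI bM; exact: rank_leq_col.
Qed.

Lemma spanned_enum (J : finType) (b : J -> T -> R) f :
  spanned b f -> spanned (fun i : 'I_#|J| => b (enum_val i)) f.
Proof.
move=> [c fc]; exists (c \o enum_val) => x; rewrite fc.
by rewrite (reindex _ (onW_bij _ (@enum_val_bij J))).
Qed.

(** An independent family in [W] of maximal size is a basis; the sizes are bounded by the cardinal
    of [J]. *)
Lemma lin_closed_has_dim (J : finType) (f : J -> T -> R) W :
  lin_closed W -> (forall v, W v -> spanned f v) -> exists n, has_dim W n.
Proof.
move=> Wlin Wf; pose P n := `[< exists b : 'I_n -> T -> R,
  (forall i, W (b i)) /\ independent b >].
have P0 : P 0%N by apply/asboolP; exists (fun _ _ => 0); split => [[]//|c _ []].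
have Pub n : P n -> (n <= #|J|)%N.
  move=> /asboolP[b [Wb bI]].
  by apply: (independent_le bI) => i; apply/spanned_enum/Wf.
have exP : exists n, P n by exists 0%N.
have [n /asboolP[b [Wb bI]] nmax] := ex_maxnP exP Pub.
exists n, b; split => // v Wv.
(* By maximality, the family with [v] put in front is dependent. *)
pose b' (i : 'I_n.+1) := if unlift ord0 i is Some j then b j else v.
have : ~ P n.+1 by move=> /nmax; rewrite ltnn.
have Wb' i : W (b' i) by rewrite /b'; case: unliftP.
have b'0 : b' ord0 = v by rewrite /b' unlift_none.
have b'S i : b' (lift ord0 i) = b i by rewrite /b' liftK.
move=> nP; have /existsNP[c /not_implyP[c0 /existsNP[i ci]]] : ~ independent b'.
  by move=> b'I; apply: nP; apply/asboolP; exists b'.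
have E x : c ord0 * v x + \sum_i c (lift ord0 i) * b i x = 0.
  rewrite -[RHS](c0 x) big_ord_recl b'0; congr (_ + _).
  by apply: eq_bigr => j _; rewrite b'S.
(* The coefficient of [v] cannot vanish, since [b] is independent; dividing by it expresses [v]. *)
have [cv|cv] := eqVneq (c ord0) 0.
  exfalso; apply: ci; have [j ->|->//] := unliftP ord0 i.
  apply: (bI (fun j => c (lift ord0 j))) => x.
  by move: (E x); rewrite cv mul0r add0r.
exists (fun i => - (c ord0)^-1 * c (lift ord0 i)) => x.
have := E x => /(canRL (addrK _)); rewrite add0r => /(canRL (mulKf cv)) ->.
rewrite mulrN -mulNr mulr_sumr; apply: eq_bigr => j _; exact: mulrA.
Qed.

End function_spaces.

(** Restriction to [D] maps a basis of [W] to a spanning family of the restrictions, so equality of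
    dimensions amounts to a trivial kernel. *)
Lemma has_dim_restrict (R : realType) T (W : set (T -> R)) (D : set T) n :
  lin_closed W -> has_dim W n ->
  has_dim [set v \_ D | v in W] n <->
  (forall v, W v -> v \_ D = (fun=> 0) -> v = (fun=> 0)).
Proof.
move=> Wlin [b [Wb bI bS]].
have restr m (h : 'I_m -> T -> R) (c : 'I_m -> R) :
    (fun x => \sum_i c i * h i x) \_ D = (fun x => \sum_i c i * (h i \_ D) x).
  apply/funext => x; rewrite patchE; case: ifPn => xD.
    by apply: eq_bigr => i _; rewrite patchE xD.
  by rewrite big1// => i _; rewrite patchE (negbTE xD) mulr0.
split=> [[b' [Wb' b'I b'S]] v Wv vD|inj].
- have b'b i : spanned (fun j => b j \_ D) (b' i).
    have [u Wu <-] := Wb' i; have [c uc] := bS u Wu; exists c => x.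
    by rewrite (funext uc) restr.
  have [M bM] := spanned_matrix b'b.
  have Mfree := row_free_independent b'I bM.
  have [c vc] := bS v Wv.
  (* [M] is square and row free, hence invertible: the coefficients of [v] turn into coefficients
     [u] of its restriction, which is zero, in the basis [b']. *)
  pose u : 'rV[R]_n := (\row_i c i) *m invmx M.
  have uM : u *m M = \row_i c i by rewrite mulmxKV// -row_free_unit.
  have u0 : u = 0.
    apply: (independent_row b'I) => x; rewrite bM uM.
    transitivity ((v \_ D) x); last by rewrite vD.
    rewrite (funext vc) restr.
    by apply: eq_bigr => i _; rewrite mxE.
  have c0 i : c i = 0.
    by have := congr1 (fun A : 'rV_n => A 0 i) uM; rewrite u0 mul0mx !mxE.
  by apply/funext => x; rewrite vc big1// => i _; rewrite c0 mul0r.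
- exists (fun i => b i \_ D); split.
  + by move=> i; exists (b i).
  + move=> c c0; apply: bI => x.
    suff : (fun y => \sum_i c i * b i y) = (fun=> 0) by move/(congr1 (@^~ x)).
    apply: inj; first exact: Wlin.
    by rewrite restr; apply/funext.
  + move=> _ [v Wv <-]; have [c vc] := bS v Wv; exists c => x.
    by rewrite (funext vc) restr.
Qed.

(** * Hausdorff measure *)

Section euclidean_norm.
Variables (R : realType) (n : nat).
Implicit Types (x y : 'rV[R]_n) (A B : set 'rV[R]_n).

Lemma dot_ge0 x : 0 <= dot x x.
Proof. by apply: sumr_ge0 => i _; rewrite -expr2 sqr_ge0. Qed.

Lemma enorm_ge0 x : 0 <= enorm x.
Proof. exact: sqrtr_ge0. Qed.

Lemma coord_le_enorm x i : `|x 0 i| <= enorm x.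
Proof.
rewrite -sqrtr_sqr ler_sqrt ?dot_ge0// /dot (bigD1 i)//= expr2 lerDl.
by apply: sumr_ge0 => j _; rewrite -expr2 sqr_ge0.
Qed.

Lemma norm_le_enorm x : `|x| <= enorm x.
Proof.
rewrite /Num.Def.normr/= mx_normrE; apply: bigmax_le; first exact: enorm_ge0.
by move=> [i j] _ /=; rewrite (ord1 i) coord_le_enorm.
Qed.

Lemma dotC x y : dot x y = dot y x.
Proof. by apply: eq_bigr => i _; rewrite mulrC. Qed.

Lemma enormB x y : enorm (x - y) = enorm (y - x).
Proof.
rewrite /enorm; congr Num.sqrt; apply: eq_bigr => i _.
by rewrite !mxE; ring.
Qed.

Lemma dotDr x y z : dot x (y + z) = dot x y + dot x z.
Proof.
rewrite /dot -big_split; apply: eq_bigr => i _ /=.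
by rewrite !mxE mulrDr.
Qed.

Lemma dotZr x y (a : R) : dot x (a *: y) = a * dot x y.
Proof.
rewrite /dot mulr_sumr; apply: eq_bigr => i _ /=.
by rewrite !mxE mulrCA.
Qed.

Lemma dotDl x y z : dot (x + y) z = dot x z + dot y z.
Proof. by rewrite dotC dotDr !(dotC z). Qed.

Lemma dotZl x y (a : R) : dot (a *: x) y = a * dot x y.
Proof. by rewrite dotC dotZr dotC. Qed.

Lemma dotBr x y z : dot x (y - z) = dot x y - dot x z.
Proof. by rewrite dotDr -scaleN1r dotZr mulN1r. Qed.

(* Cauchy-Schwarz: the discriminant of t |-> |x - t y|^2 is nonpositive. *)
Lemma dot_le_enorm x y : `|dot x y| <= enorm x * enorm y.
Proof.
rewrite -sqrtrM ?dot_ge0// -sqrtr_sqr ler_sqrt ?mulr_ge0 ?dot_ge0//.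
have Q t : 0 <= dot x x - t * (dot x y *+ 2) + t ^+ 2 * dot y y.
  rewrite (_ : _ + _ = dot (x - t *: y) (x - t *: y)) ?dot_ge0//.
  rewrite /dot mulrnAr !mulr_sumr -!sumrMnl -sumrB -big_split.
  by apply: eq_bigr => i _ /=; rewrite !mxE; ring.
have [y0|y0] := eqVneq (dot y y) 0.
  rewrite y0 mulr0; have [->|xy] := eqVneq (dot x y) 0; first by rewrite expr0n.
  have := Q ((dot x x + 1) / (dot x y *+ 2)).
  rewrite y0 divfK ?mulrn_eq0//; lra.
have {}y0 : 0 < dot y y by rewrite lt_neqAle eq_sym y0 dot_ge0.
have := Q (dot x y / dot y y).
have -> : dot x x - dot x y / dot y y * (dot x y *+ 2) +
    (dot x y / dot y y) ^+ 2 * dot y y = dot x x - dot x y ^+ 2 / dot y y.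
  by field; rewrite gt_eqF.
by rewrite subr_ge0 ler_pdivrMr.
Qed.

Lemma enormD x y : enorm (x + y) <= enorm x + enorm y.
Proof.
rewrite -ler_sqr ?nnegrE ?addr_ge0 ?enorm_ge0// sqrrD.
rewrite !sqr_sqrtr ?dot_ge0//.
rewrite dotDl !dotDr (dotC y x) addrA -(addrA (dot x x)) -mulr2n.
rewrite lerD2r lerD2l lerMn2r/=.
by rewrite (le_trans (ler_norm _))// dot_le_enorm.
Qed.

Lemma enormZ (a : R) x : enorm (a *: x) = `|a| * enorm x.
Proof. by rewrite /enorm dotZl dotZr mulrA -expr2 sqrtrM ?sqr_ge0// sqrtr_sqr.
  Qed.

Lemma coord_le_norm x i : `|x 0 i| <= `|x|.
Proof.
rewrite [leRHS]/Num.Def.normr/= mx_normrE.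
exact: (le_bigmax _ (fun i : 'I_1 * 'I_n => `|x i.1 i.2|) (0, i)).
Qed.

Lemma enorm_le_norm x : enorm x <= n%:R * `|x|.
Proof.
have h : dot x x <= (n%:R * `|x|) ^+ 2.
  apply: (@le_trans _ _ (\sum_(i < n) `|x| ^+ 2)).
    apply: ler_sum => i _; rewrite -expr2 -real_normK ?num_real//.
    by rewrite lerXn2r ?nnegrE ?coord_le_norm.
  rewrite sumr_const card_ord -[leLHS]mulr_natl exprMn ler_wpM2r ?sqr_ge0//.
  rewrite -natrX ler_nat; case: (n) => // m.
  by rewrite expnS leq_pmulr.
rewrite /enorm -[leRHS]ger0_norm ?mulr_ge0// -sqrtr_sqr ler_sqrt//.
Qed.

Lemma enorm_le_diam A x y : A x -> A y -> ((enorm (x - y))%:E <= diam A)%E.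
Proof. by move=> Ax Ay; apply: ereal_sup_ubound; right; exists (x, y). Qed.

Lemma le_diam A B : A `<=` B -> (diam A <= diam B)%E.
Proof.
move=> AB; apply: ereal_sup_le => _ [->|[p [pA pA'] <-]]; first by left.
by right; exists p => //; split; exact: AB.
Qed.
End euclidean_norm.

Section hausdorff_measure.
Import HBNNSimple.
Variable R : realType.
Local Open Scope ereal_scope.
Implicit Types (A B C X : set 'rV[R]_3).
Local Notation mu := (@hausdorff2 R).

Lemma le_hausdorff2_pre A (d d' : R) :
  (d <= d')%R -> hausdorff2_pre d' A <= hausdorff2_pre d A.
Proof.
move=> dd'; apply: ereal_inf_le_tmp => _ [C [AC dC] <-]; exists C => //;
  split=> //.
by move=> i; rewrite (le_trans (dC i))// lee_fin.
Qed.

Lemma le_hausdorff2_weight A B :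
  A `<=` B -> hausdorff2_weight A <= hausdorff2_weight B.
Proof.
move=> AB; apply: lee_pmul => //; first by rewrite lee_fin divr_ge0 ?pi_ge0.
  by rewrite mule_ge0 ?diam_ge0.
by apply: lee_pmul; rewrite ?diam_ge0 ?le_diam.
Qed.

Lemma hausdorff2_weight0 : hausdorff2_weight (set0 : set 'rV[R]_3) = 0.
Proof. by rewrite /hausdorff2_weight diam0 !mule0. Qed.

Definition separated_by (eta : R) A B :=
  forall x y, A x -> B y -> (eta <= enorm (x - y))%R.

(* A set of diameter less than eta meets at most one of A and B, so a fine
   cover of the union splits into a cover of A and a cover of B. *)
Lemma hausdorff2_pre_separated A B (eta d : R) : separated_by eta A B ->
  (d < eta)%R ->
  hausdorff2_pre d A + hausdorff2_pre d B <= hausdorff2_pre d (A `|` B).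
Proof.
move=> AB deta; apply: le_ereal_inf_tmp => _ [C [ABC dC] <-].
apply: (@le_trans _ _ (\sum_(i <oo) hausdorff2_weight (C i `&` A) +
                       \sum_(i <oo) hausdorff2_weight (C i `&` B))).
  have sub D : D `<=` A `|` B -> hausdorff2_pre d D <=
      \sum_(i <oo) hausdorff2_weight (C i `&` D).
    move=> DAB; apply: ereal_inf_lbound; exists (fun i => C i `&` D) => //.
    split=> [x Dx|i].
      by have [i _ Cix] := ABC _ (DAB _ Dx); exists i.
    by rewrite (le_trans _ (dC i))// le_diam.
  by apply: leeD; apply: sub => x; [left|right].
rewrite -nneseriesD; try by move=> i _ _; exact: hausdorff2_weight_ge0.
apply: lee_nneseries => [i _ _|i _];
  first by rewrite adde_ge0 ?hausdorff2_weight_ge0.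
have [A0|/set0P[x [Cx Ax]]] := eqVneq (C i `&` A) set0.
  by rewrite A0 hausdorff2_weight0 add0e le_hausdorff2_weight.
have [B0|/set0P[y [Cy By]]] := eqVneq (C i `&` B) set0.
  by rewrite B0 hausdorff2_weight0 adde0 le_hausdorff2_weight.
have := le_trans (enorm_le_diam Cx Cy) (dC i).
by rewrite lee_fin leNgt (lt_le_trans deta)//; exact: AB.
Qed.

(** Below the scale [eta] the premeasures are superadditive; the suprema over the scales for [A] and
    for [B] are then taken one after the other. *)
Lemma hausdorff2_separated A B (eta : R) : (0 < eta)%R ->
  separated_by eta A B -> mu A + mu B <= mu (A `|` B).
Proof.
move=> eta0 AB.
have [->|muAB] := eqVneq (mu (A `|` B)) +oo; first by rewrite leey.
have fin D : D `<=` A `|` B -> mu D \is a fin_num.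
  move=> DAB; rewrite ge0_fin_numE ?hausdorff2_ge0//.
  by rewrite (le_lt_trans (le_hausdorff2 DAB))// ltey.
have fA : mu A \is a fin_num by apply: fin => x; left.
have fB : mu B \is a fin_num by apply: fin => x; right.
have key d d' : (0 < d)%R -> (0 < d')%R ->
    hausdorff2_pre d A + hausdorff2_pre d' B <= mu (A `|` B).
  (* Halving [eta] makes the common scale strictly smaller than the separation. *)
  move=> d0 d'0; pose m := (Num.min (Num.min d d') (eta / 2))%R.
  have m0 : (0 < m)%R by rewrite !lt_min d0 d'0 divr_gt0.
  apply: (@le_trans _ _ (hausdorff2_pre m A + hausdorff2_pre m B)).
    by apply: leeD; apply: le_hausdorff2_pre; rewrite !ge_min lexx ?orbT.
  apply: (@le_trans _ _ (hausdorff2_pre m (A `|` B))).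
    apply: (hausdorff2_pre_separated AB).
    rewrite gt_min; apply/orP; right; lra.
  by apply: ereal_sup_ubound; exists m.
have leN d' : (0 < d')%R -> mu A + hausdorff2_pre d' B <= mu (A `|` B).
  move=> d'0; have fB' : hausdorff2_pre d' B \is a fin_num.
    rewrite ge0_fin_numE ?hausdorff2_pre_ge0// (@le_lt_trans _ _ (mu B))//.
      by apply: ereal_sup_ubound; exists d'.
    by rewrite ltey_eq fB.
  rewrite -leeBrDr//; apply: ge_ereal_sup => _ [d d0 <-].
  by rewrite leeBrDr//; exact: key.
rewrite -leeBrDl//; apply: ge_ereal_sup => _ [d d0 <-].
by rewrite leeBrDl//; exact: leN.
Qed.

(** * Closed sets are measurable for a metric outer measure *)

Section closed_measurable.
Variables (C X : set 'rV[R]_3).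
Hypothesis Cclosed : closed C.

Let far n : set 'rV[R]_3 :=
  [set x | X x /\ forall y, C y -> (n.+1%:R^-1 <= enorm (x - y))%R].
Let shell n := far n.+1 `\` far n.

Let far_le m n : (m <= n)%N -> far m `<=` far n.
Proof.
move=> mn x [Xx xC]; split=> // y /xC; apply: le_trans.
by rewrite lef_pV2 ?posrE ?ltr0n// ler_nat.
Qed.

Let far_sub n : far n `<=` X.
Proof. by move=> x []. Qed.

(** A point of the shell has a point of [C] closer than 1/(n+2), while points of [far n] keep
    distance 1/(n+1) from [C]; the triangle inequality separates the two sets. *)
Let far_shell n : mu (far n) + mu (shell n.+1) <= mu (far n.+2).
Proof.
apply: (@le_trans _ _ (mu (far n `|` shell n.+1))); last first.
  by apply: le_hausdorff2 => x [|[]//]; exact: (far_le (leqW (leqnSn n))).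
apply: (@hausdorff2_separated _ _ (n.+1%:R^-1 - n.+2%:R^-1)).
  by rewrite subr_gt0 ltf_pV2 ?posrE ?ltr0n// ltr_nat.
move=> x z [Xx xC] [[Xz _] zC].
have : exists2 y, C y & (enorm (z - y) < n.+2%:R^-1)%R.
  apply: contrapT => H; apply: zC; split=> // y Cy; rewrite leNgt.
  by apply/negP => zy; apply: H; exists y.
move=> [y Cy zy]; have xy := xC y Cy.
have := enormD (x - z) (z - y); rewrite addrA subrK => xzy.
by rewrite lerBlDr (le_trans xy)// (le_trans xzy)// lerD2l ltW.
Qed.

(** The induction step absorbs the new shell by [far_shell] into the older of the two terms, which
    amounts to summing the shells of even and of odd index separately. *)
Let shell_sum N : \sum_(k < N) mu (shell k) <= mu (far N) + mu (far N.-1).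
Proof.
case: N => [|N]; first by rewrite big_ord0 adde_ge0 ?hausdorff2_ge0.
elim: N => [|N IH].
  rewrite big_ord1 (le_trans (le_hausdorff2 (@subDsetl _ _ _)))//.
  by rewrite leeDl ?hausdorff2_ge0.
rewrite big_ord_recr/= (le_trans (leeD2r _ IH))//.
by rewrite -addeA addeC leeD2r// far_shell.
Qed.

(** A point off the closed set [C] has positive distance from it and so lies in some [far m]; going
    down from m, it is found in [far n] or in a later shell. *)
Let cover n : X `&` ~` C `<=`
  far n `|` \bigcup_(k in ~` `I_n) shell k.
Proof.
move=> x [Xx nCx].
have /nbhs_ballP[e /= e0 eC] : nbhs x (~` C).
  by apply: open_nbhs_nbhs; split=> //; exact: closed_openC.
have [m em] : exists m, (m.+1%:R^-1 < e)%R.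
  exists (Num.bound e^-1); rewrite invf_plt ?posrE ?ltr0n//.
  have /ltW/archi_boundP/lt_trans : (0 < e^-1)%R by rewrite invr_gt0.
  by apply; rewrite ltr_nat.
have xm : far m x.
  split=> // y Cy; rewrite leNgt; apply/negP => xy.
  apply: (eC y) => //=; rewrite -ball_normE /=.
  by rewrite (le_lt_trans (norm_le_enorm _))// (lt_trans xy).
elim: m xm {em} => [|m IH] xm.
  by left; exact: far_le xm.
have [/IH//|nx] := pselect (far m x).
have [mn|nm] := ltnP m n; first by left; exact: far_le xm.
by right; exists m; [rewrite /= ltnNge nm|].
Qed.

(** Each [far n] is separated from [C]; what it misses of the complement lies in the shells from n
    on, whose measures form the tail of a convergent series. *)
Lemma closed_hausdorff2_split : mu (X `&` C) + mu (X `&` ~` C) <= mu X.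
Proof.
have [->|muX] := eqVneq (mu X) +oo; first by rewrite leey.
have fX : mu X \is a fin_num by rewrite ge0_fin_numE ?hausdorff2_ge0// ltey.
have split n : mu (X `&` C) + mu (far n) <= mu X.
  apply: (@le_trans _ _ (mu ((X `&` C) `|` far n))).
    apply: (@hausdorff2_separated _ _ n.+1%:R^-1); first by rewrite invr_gt0.
    by move=> x y [_ Cx] [_ yC]; rewrite enormB; exact: yC.
  by apply: le_hausdorff2 => x [[]|/far_sub].
(* By [shell_sum], the partial sums are at most twice the measure of [X]. *)
have sumfin : \sum_(k <oo) mu (shell k) < +oo.
  apply: (@le_lt_trans _ _ (mu X + mu X)); last first.
    by rewrite lte_add_pinfty// ltey_eq fX.
  apply: lime_le.
    by apply: is_cvg_nneseries => k _ _; exact: hausdorff2_ge0.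
  apply: nearW => N; rewrite big_mkord (le_trans (shell_sum N))//.
  by apply: leeD; apply: le_hausdorff2; exact: far_sub.
have tail := @nneseries_tail_cvg _ (fun k => mu (shell k)) xpredT sumfin
  (fun k _ => hausdorff2_ge0 _).
apply/lee_addgt0Pr => e e0.
have [N _ /(_ N (leqnn N))/= tN] : \forall N \near \oo,
    \sum_(N <= k <oo) mu (shell k) < e%:E.
  have e0' : nbhs (0%:E : \bar R) [set y | y < e%:E].
    exact: (@nbhs_open_ereal_lt _ 0%R (fun=> e)).
  exact: (tail _ e0').
apply: (@le_trans _ _ (mu (X `&` C) +
    (mu (far N) + \sum_(N <= k <oo) mu (shell k)))); last first.
  by rewrite addeA leeD// ltW.
apply: leeD2l; apply: (le_trans (le_hausdorff2 (@cover N))).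
apply: (le_trans (outer_measureU2 _ _ _)); apply: leeD2l.
exact: outer_measure_sigma_subadditive_tail.
Qed.
End closed_measurable.

Lemma closed_caratheodory C : closed C -> mu.-caratheodory C.
Proof.
by move=> Cc; apply: le_caratheodory_measurable => X;
  exact: closed_hausdorff2_split.
Qed.

(** The integral of a nonnegative function is a supremum over simple functions below it, and [c]
    times the indicator of [B] is one with positive integral. *)
Lemma area_integral_neq0 B D (f : 'rV[R]_3 -> R) (c : R) :
  closed B -> B `<=` D -> mu B <> 0 -> (0 < c)%R ->
  (forall x, D x -> (0 <= f x)%R) -> (forall x, B x -> (c <= f x)%R) ->
  (\int[@area R]_(x in D) (f x)%:E)%E <> 0.
Proof.
move=> Bc BD muB c0 f0 cf.
have mB : measurable (B : set (caratheodory_type mu)).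
  exact: closed_caratheodory.
pose g := scale_nnsfun (indic_nnsfun R mB) (ltW c0).
rewrite ge0_integralE; last by move=> x /f0; rewrite lee_fin.
apply/eqP; rewrite gt_eqF//.
apply: (@lt_le_trans _ _ (sintegral (@area R) g)).
  rewrite sintegralrM sintegral_indic// mule_gt0 ?lte_fin//.
  by rewrite lt_neqAle measure_ge0 andbT eq_sym; apply/eqP.
apply: ereal_sup_ubound; exists g => //= x.
rewrite -[X in X%:E <= _]/(c * \1_B x)%R patchE;
  case: ifPn => [/set_mem Dx|/negP xD].
  rewrite lee_fin indicE; have [Bx|Bx] := boolP (x \in B).
    by rewrite mulr1; exact/cf/set_mem.
  by rewrite mulr0 f0.
by rewrite lee_fin indicE memNset ?mulr0// => /BD Dx; apply: xD; rewrite inE.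
Qed.

(** * Lower bounds for the Hausdorff measure from coordinate projections *)

Section box_measure.
Local Notation leb := (@lebesgue_measure R).

Lemma square_measure (a b d : R) : (0 <= d)%R ->
  (leb \x leb) (`[(a - d)%R, (a + d)%R] `*` `[(b - d)%R, (b + d)%R]) =
  (4 * d ^+ 2)%:E.
Proof.
move=> d0; have len (t : R) : leb `[(t - d)%R, (t + d)%R] = (d *+ 2)%:E.
  rewrite lebesgue_measure_itv/= lte_fin ltrBlDr -addrA -mulr2n ltrDl.
  case: ltP => [_|d_le0]; first by rewrite -EFinB; congr (_%:E); ring.
  (* The remaining case is an interval reduced to a point. *)
  have /eqP -> : d == 0%R by rewrite eq_le d0 andbT -(@pmulrn_lle0 _ _ 2).
  by rewrite mul0rn.
transitivity (leb `[(a - d)%R, (a + d)%R] * leb `[(b - d)%R, (b + d)%R]).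
  exact: product_measure1E.
rewrite !len -EFinM; congr (_%:E).
by ring.
Qed.

Variables (i j : 'I_3) (S : set 'rV[R]_3) (a b r : R).
Hypothesis r0 : (0 < r)%R.
Hypothesis Sproj : forall s t : R, (`|s - a| <= r)%R -> (`|t - b| <= r)%R ->
  exists y, [/\ S y, y 0%R i = s & y 0%R j = t].

(** The projection lies in the square of half-side d = diam [C] around the projection of a point of
    [C]; its area 4 d^2 times pi/16 is the weight of [C]. The bound by 1 makes d finite. *)
Let weight_box (C : set 'rV[R]_3) : diam C <= 1%:E -> exists B : set (R * R),
  [/\ measurable B, forall y, C y -> B (y 0%R i, y 0%R j) &
      (pi / 16)%:E * (leb \x leb) B <= hausdorff2_weight C].
Proof.
move=> C1; have [->|/set0P[c Cc]] := eqVneq C set0.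
  by exists set0; rewrite measure0 mule0 hausdorff2_weight_ge0.
have fC : diam C \is a fin_num.
  by rewrite ge0_fin_numE ?diam_ge0// (le_lt_trans C1)// ltry.
have dC0 : (0 <= fine (diam C))%R by rewrite fine_ge0 ?diam_ge0.
pose d := fine (diam C).
exists (`[(c 0%R i - d)%R, (c 0%R i + d)%R] `*` `[(c 0%R j - d)%R,
  (c 0%R j + d)%R]).
split; first exact: measurableX.
  move=> y Cy; have yc k : (`|y 0%R k - c 0%R k| <= d)%R.
    rewrite -lee_fin /d fineK// (le_trans _ (enorm_le_diam Cy Cc))// lee_fin.
    by have := coord_le_enorm (y - c)%R k; rewrite !mxE.
  by split; rewrite /= in_itv/= -ler_distl.
rewrite (@square_measure _ _ d dC0) /hausdorff2_weight -(fineK fC) -/d -!EFinM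
  lee_fin.
rewrite le_eqVlt; apply/orP; left; by apply/eqP; field.
Qed.

(* Coordinate projections do not increase diameters, so each set of a cover
   of S projects into a box whose area is controlled by its weight. *)
Lemma hausdorff2_neq0 : mu S <> 0.
Proof.
move=> S0; have pre0 : hausdorff2_pre 1 S = 0.
  apply/eqP; rewrite eq_le hausdorff2_pre_ge0 andbT -S0.
  by apply: ereal_sup_ubound; exists 1%R => /=.
(* The threshold is pi/16 times the area 4 r^2 of the square that the projection of [S] contains. *)
have : ereal_inf [set \sum_(i <oo) hausdorff2_weight (C i) |
             C in hausdorff2_cover 1 S] < (pi / 4 * r ^+ 2)%:E.
  rewrite -/(hausdorff2_pre 1 S) pre0 lte_fin.
  by rewrite mulr_gt0 ?exprn_gt0// divr_gt0 ?pi_gt0.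
move=> /ereal_inf_lt[_ [C [SC C1] <-]]; apply/negP; rewrite -leNgt.
have /choice[B BP] n := weight_box (C1 n).
apply: (@le_trans _ _ (\sum_(n <oo) (pi / 16)%:E * (leb \x leb) (B n)));
    last first.
  apply: lee_nneseries => n _; last by case: (BP n).
  by rewrite mule_ge0// lee_fin divr_ge0// pi_ge0.
rewrite nneseriesZl//; apply: (@le_trans _ _ ((pi / 16)%:E * (4 * r ^+ 2)%:E)).
  by rewrite -EFinM lee_fin le_eqVlt; apply/orP; left; by apply/eqP; field.
apply: lee_wpmul2l; first by rewrite lee_fin divr_ge0// pi_ge0.
rewrite -(square_measure a b (ltW r0)); apply: measure_sigma_subadditive.
- by move=> n; case: (BP n).
- exact: measurableX.
- move=> [s t] [/=]; rewrite !in_itv/= -!ler_distl => sa tb.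
  have [y [Sy <- <-]] := Sproj sa tb; have [n _ Cy] := SC _ Sy.
  by exists n => //; case: (BP n) => _ /(_ _ Cy).
Qed.
End box_measure.
End hausdorff_measure.

(** * Gradients *)

Section gradients.
Variable R : realType.

(** A gradient is a row vector [d] standing for the differential [dot d]; linearity is registered so
    that uniqueness of the differential applies. *)
HB.instance Definition _ n (d : 'rV[R]_n) := GRing.isLinear.Build
  R 'rV[R]_n R _ (dot d) (fun a x y =>
    etrans (dotDr d (a *: x) y) (congr1 (+%R^~ (dot d y)) (dotZr d x a))).

Lemma continuous_dot n (d : 'rV[R]_n.+1) : continuous (dot d).
Proof.
have addc : continuous (fun z : R * R => z.1 + z.2) by exact: add_continuous.
move=> x; have FF : Filter (nbhs x) by exact: nbhs_filter.
apply: (cvg_big addc FF) => i _.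
by apply: cvgM; [exact: cvg_cst|exact: coord_continuous].
Qed.

(** Turns differentials into remainder bounds like those defining surface gradients, though in the
    sup norm. *)
Lemma is_diff_dotP n (d : 'rV[R]_n.+1) (f : 'rV[R]_n.+1 -> R) x :
  is_diff x f (dot d) <-> forall e, 0 < e ->
    \forall y \near x, `|f y - f x - dot d (y - x)| <= e * `|y - x|.
Proof.
split=> [[df dE] e e0|H].
  have /eqaddoP/(_ e e0) := diff_locally df; rewrite dE => H.
  rewrite (near_shift 0 x); apply: filterS H => h /=.
  by rewrite !fctE /= !subr0 addrK opprD addrA.
have E : f \o shift x = cst (f x) + dot d +o_ 0 id.
  apply/eqaddoP => e e0; have := H e e0; rewrite (near_shift 0 x).
  apply: filterS => h /=.
  by rewrite !fctE /= !subr0 addrK opprD addrA.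
have dE : 'd f x = dot d :> ('rV[R]_n.+1 -> R).
  by apply: diff_unique E; exact: continuous_dot.
by split=> //; apply/diff_locallyP; rewrite dE; split=> //;
  exact: continuous_dot.
Qed.

Section C1.
Variable n : nat.
Implicit Types (D : set 'rV[R]_n.+1) (f g : 'rV[R]_n.+1 -> R).

Definition is_grad D f (df : 'rV[R]_n.+1 -> 'rV[R]_n.+1) :=
  forall x, D x -> {for x, continuous df} /\ is_diff x f (dot (df x)).

Definition C1 D f := exists df, is_grad D f df.

Lemma is_grad_continuous D f df x :
  is_grad D f df -> D x -> {for x, continuous f}.
Proof. by move=> Df /Df[_ [fx _]]; exact: differentiable_continuous. Qed.

Lemma C1_cst D (c : R) : C1 D (cst c).
Proof.
exists (fun=> 0) => x _; split; first exact: cst_continuous.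
apply: is_diff_eq; apply/funext => y.
by rewrite /dot big1// => i _; rewrite mxE mul0r.
Qed.

Lemma dot_delta i (x : 'rV[R]_n.+1) : dot (delta_mx 0 i) x = x 0 i.
Proof.
rewrite /dot (bigD1 i)//= big1 => [|j ji]; last first.
  by rewrite mxE (negbTE ji) andbF mul0r.
by rewrite !mxE !eqxx mul1r addr0.
Qed.

Lemma is_grad_coord D i : is_grad D (fun x => x 0 i) (fun=> delta_mx 0 i).
Proof.
move=> x _; split; first exact: cst_continuous.
apply/is_diff_dotP => e e0; near=> y.
by rewrite dot_delta !mxE subrr normr0 mulr_ge0// ltW.
Unshelve. all: by end_near. Qed.

Lemma C1_coord D i : C1 D (fun x => x 0 i).
Proof. by exists (fun=> delta_mx 0 i); exact: is_grad_coord. Qed.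

Lemma C1D D f g : C1 D f -> C1 D g -> C1 D (fun x => f x + g x).
Proof.
move=> [df Df] [dg Dg]; exists (fun x => df x + dg x) => x Dx.
have [cf ff] := Df x Dx; have [cg gg] := Dg x Dx.
split; first exact: continuousD.
apply: is_diff_eq; apply/funext => y.
by rewrite dotDl.
Qed.

Lemma C1M D f g : C1 D f -> C1 D g -> C1 D (fun x => f x * g x).
Proof.
move=> [df Df] [dg Dg]; exists (fun x => f x *: dg x + g x *: df x) => x Dx.
have [cf ff] := Df x Dx; have [cg gg] := Dg x Dx.
have := is_grad_continuous Df Dx; have := is_grad_continuous Dg Dx => cg' cf'.
split; first by apply: continuousD; apply: continuousZ.
apply: is_diff_eq; apply/funext => y.
by rewrite dotDl !dotZl.
Qed.

Lemma C1_sum D (J : Type) (r : seq J) (P : pred J) (F : J -> 'rV[R]_n.+1 -> R) :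
  (forall i, C1 D (F i)) -> C1 D (fun x => \sum_(i <- r | P i) F i x).
Proof.
move=> CF; elim: r => [|i r IH].
  by rewrite (_ : (fun=> _) = cst 0); [exact: C1_cst|apply/funext=> x;
    rewrite big_nil].
have [Pi|Pi] := boolP (P i).
  rewrite (_ : (fun=> _) = fun x => F i x + \sum_(i <- r | P i) F i x).
    exact: C1D.
  by apply/funext => x; rewrite big_cons Pi.
rewrite (_ : (fun=> _) = fun x => \sum_(i <- r | P i) F i x)//.
by apply/funext => x; rewrite big_cons (negbTE Pi).
Qed.

Lemma C1_prod D (J : Type) (r : seq J) (F : J -> 'rV[R]_n.+1 -> R) :
  (forall i, C1 D (F i)) -> C1 D (fun x => \prod_(i <- r) F i x).
Proof.
move=> CF; elim: r => [|i r IH].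
  by rewrite (_ : (fun=> _) = cst 1); [exact: C1_cst|apply/funext=> x;
    rewrite big_nil].
rewrite (_ : (fun=> _) = fun x => F i x * \prod_(i <- r) F i x).
  exact: C1M.
by apply/funext => x; rewrite big_cons.
Qed.

Lemma C1X D f k : C1 D f -> C1 D (fun x => f x ^+ k).
Proof.
move=> Cf; rewrite (_ : (fun=> _) = fun x => \prod_(i < k) f x).
  exact: C1_prod.
by apply/funext => x; rewrite prodr_const card_ord.
Qed.
End C1.

(** * Mean value theorems and continuously differentiable functions in the plane *)

Lemma line_MVT n (f : 'rV[R]_n.+1 -> R) (x v : 'rV[R]_n.+1) (h : R) :
  (forall t : R, `|t| <= `|h| -> derivable f (t *: v + x) v) ->
  exists2 t : R, `|t| <= `|h| & f (h *: v + x) - f x = h * 'D_v f (t *: v + x).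
Proof.
move=> fv; pose phi (t : R) := f (t *: v + x).
have dphi (t : R) : `|t| <= `|h| -> is_derive t (1 :
  R) phi ('D_v f (t *: v + x)).
  move=> /fv; rewrite /derivable /derive; set q := (X in cvg (X @ _)) => cq.
  have qE : (fun k => k^-1 *: ((phi \o shift t) (k *: 1) - phi t)) = q.
    apply/funext => k; rewrite /q /phi /= [k%:A]mulr1.
    by rewrite scalerDl addrA.
  by split; [rewrite /derivable qE|rewrite /derive qE].
(* The one-dimensional theorem runs over an ordered segment, so the signs of [h] are treated
   apart. *)
have [h0|h0] := leP 0 h.
- have [t th phiE] : exists2 t, t \in `[0, h]%R &
      phi h - phi 0 = 'D_v f (t *: v + x) * (h - 0).
    apply: MVT_segment => // [t|].
      rewrite in_itv/= => /andP[t0 th]; apply: dphi.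
      by rewrite !ger0_norm// ltW.
    apply: derivable_within_continuous => t; rewrite in_itv/= => /andP[t0 th].
    by apply: ex_derive; apply: dphi; rewrite !ger0_norm.
  exists t; first by move: th; rewrite in_itv/= => /andP[t0 th];
    rewrite !ger0_norm.
  by move: phiE; rewrite /phi scale0r add0r subr0 mulrC.
- have [t th phiE] : exists2 t, t \in `[h, 0]%R &
      phi 0 - phi h = 'D_v f (t *: v + x) * (0 - h).
    apply: MVT_segment => [|t|]; first exact: ltW.
      rewrite in_itv/= => /andP[ht t0]; apply: dphi.
      by rewrite !ltr0_norm// lerN2 ltW.
    apply: derivable_within_continuous => t; rewrite in_itv/= => /andP[ht t0].
    by apply: ex_derive; apply: dphi; rewrite ler0_norm// ltr0_norm// lerN2.
  exists t.
    move: th; rewrite in_itv/= => /andP[ht t0].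
    by rewrite ler0_norm// ltr0_norm// lerN2.
  move: phiE; rewrite /phi scale0r add0r => phiE.
  by rewrite -opprB phiE sub0r mulrN opprK mulrC.
Qed.

Lemma row2E (x : 'rV[R]_2) :
  x = x 0 ord_max *: delta_mx 0 ord_max + x 0 ord0 *: delta_mx 0 ord0.
Proof.
apply/rowP => i; rewrite !mxE /=.
have [->|->] : i = ord0 \/ i = ord_max by case: i => [[|[|//]] ?];
  [left|right]; exact/val_inj.
  by rewrite /= mulr0 mulr1 add0r.
by rewrite /= mulr0 mulr1 addr0.
Qed.

Lemma norm_row2_le (a b c : R) : 0 <= c -> `|a| <= c -> `|b| <= c ->
  `|a *: delta_mx 0 ord_max + b *: delta_mx 0 ord0 : 'rV[R]_2| <= c.
Proof.
move=> c0 ac bc; rewrite /Num.Def.normr/= mx_normrE;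
  apply: bigmax_le => // -[i j] _.
rewrite (ord1 i) !mxE /=.
have [->|->] : j = ord0 \/ j = ord_max by case: j => [[|[|//]] ?];
  [left|right]; exact/val_inj.
  by rewrite /= mulr0 mulr1 add0r.
by rewrite /= mulr0 mulr1 addr0.
Qed.

(** The path from [x] to [y] follows the two coordinate directions in turn, with corner [m]; in the
    sup norm it never leaves the ball of radius |y - x| around [x]. *)
Lemma plane_MVT (f : 'rV[R]_2 -> R) x y :
  (forall i z, `|z - x| <= `|y - x| -> derivable f z (delta_mx 0 i)) ->
  exists z : 'I_2 -> 'rV[R]_2, (forall i, `|z i - x| <= `|y - x|) /\
    f y - f x = \sum_i (y - x) 0 i * 'D_(delta_mx 0 i) f (z i).
Proof.
move=> fd; set u := y - x; set m := u 0 ord0 *: delta_mx 0 ord0 + x.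
have nu0 : 0 <= `|u| by [].
have [t0 t0u E0] : exists2 t, `|t| <= `|u 0 ord0| &
    f (u 0 ord0 *: delta_mx 0 ord0 + x) - f x =
    u 0 ord0 * 'D_(delta_mx 0 ord0) f (t *: delta_mx 0 ord0 + x).
  apply: line_MVT => t tu; apply: fd; rewrite addrK.
  rewrite -[X in `|X|]add0r -[X in `|X + _|](scale0r (delta_mx 0 ord_max)).
  by apply: norm_row2_le; rewrite ?normr0// (le_trans tu)// coord_le_norm.
have [t1 t1u E1] : exists2 t, `|t| <= `|u 0 ord_max| &
    f (u 0 ord_max *: delta_mx 0 ord_max + m) - f m =
    u 0 ord_max * 'D_(delta_mx 0 ord_max) f (t *: delta_mx 0 ord_max + m).
  apply: line_MVT => t tu; apply: fd; rewrite addrA addrK.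
  by apply: norm_row2_le; rewrite ?coord_le_norm// (le_trans tu)//
    coord_le_norm.
exists (fun i => if i == ord0 then t0 *: delta_mx 0 ord0 + x
                 else t1 *: delta_mx 0 ord_max + m); split=> [i|].
  case: ifP => _; rewrite ?[X in `|X - _|]addrA addrK.
    rewrite -[X in `|X|]add0r -[X in `|X + _|](scale0r (delta_mx 0 ord_max)).
    by apply: norm_row2_le; rewrite ?normr0// (le_trans t0u)// coord_le_norm.
  by apply: norm_row2_le; rewrite ?coord_le_norm// (le_trans t1u)//
    coord_le_norm.
have -> : y = u 0 ord_max *: delta_mx 0 ord_max + m.
  by rewrite /m addrA -row2E /u subrK.
rewrite -(subrK (f m) (f _)) E1 -addrA E0 addrC.
rewrite big_ord_recl big_ord_recl big_ord0 addr0 /=.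
by rewrite (_ : lift ord0 ord0 = ord_max)//; exact/val_inj.
Qed.

(** [plane_MVT] writes an increment with partial derivatives at nearby points, and their continuity
    bounds the error against those at [x]. *)
Lemma Cn1_C1 (D : set 'rV[R]_2) f : open D -> Cn 1 D f -> C1 D f.
Proof.
move=> oD [_ df]; exists (fun x => \row_i 'D_(delta_mx 0 i) f x) => x Dx; split.
  apply/(@cvgrPdist_le _ _ _ (nbhs x)) => e e0; near=> y.
  rewrite /Num.Def.normr/= mx_normrE; apply: bigmax_le => [|[i j] _ /=];
    first exact: ltW.
  rewrite !mxE; move: j {i}; near: y; apply: filter_forall => j.
  have [_ [cj _]] := df j.
  by move/cvgrPdist_le : (cj x Dx); apply.
apply/is_diff_dotP => e e0.
(* Half of [e] goes to each of the two coordinates. *)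
have e20 : 0 < e / 2 by rewrite divr_gt0.
have : \forall y \near x, D y /\ forall i,
    `|'D_(delta_mx 0 i) f x - 'D_(delta_mx 0 i) f y| <= e / 2.
  near=> y; split; first by near: y; exact: open_nbhs_nbhs.
  near: y; apply: filter_forall => i; have [_ [ci _]] := df i.
  by move/cvgrPdist_le : (ci x Dx); apply.
move=> /nbhs_ballP[r /= r0 Hr]; near=> y.
have yr : `|y - x| < r.
  suff : ball x r y by rewrite -ball_normE /= distrC.
  by near: y; exact: nbhsx_ballx.
have inr z : `|z - x| <= `|y - x| -> ball x r z.
  by move=> zy; rewrite -ball_normE /= distrC (le_lt_trans zy).
have [z [zy ->]] : exists z : 'I_2 -> 'rV[R]_2, (forall i,
  `|z i - x| <= `|y - x|) /\
    f y - f x = \sum_i (y - x) 0 i * 'D_(delta_mx 0 i) f (z i).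
  apply: plane_MVT => i z /inr /Hr[Dz _].
  by have [di _] := df i; exact: di.
rewrite /dot -sumrB (le_trans (ler_norm_sum _ _ _))//.
apply: (@le_trans _ _ (\sum_(i < 2) e / 2 * `|y - x|)); last first.
  by rewrite sumr_const card_ord -mulr_natr; lra.
apply: ler_sum => i _; have [_ /(_ i) ?] := Hr _ (inr _ (zy i)).
by rewrite [X in _ - X * _]mxE mulrC -mulrBl normrM ler_pM ?coord_le_norm//
  distrC.
Unshelve. all: by end_near. Qed.

Lemma locally_constant (f : 'rV[R]_2 -> R) (x : 'rV[R]_2) (r : R) :
  (forall y, `|y - x| < r -> is_diff y f (dot 0)) ->
  forall y : 'rV[R]_2, `|y - x| < r -> f y = f x.
Proof.
move=> f0 y yr; apply/eqP; rewrite -subr_eq0; apply/eqP.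
have dz (z : 'rV[R]_2) : `|z - x| <= `|y - x| -> is_diff z f (dot 0).
  by move=> zy; apply: f0; exact: le_lt_trans yr.
have [z [zy ->]] : exists z : 'I_2 -> 'rV[R]_2, (forall i,
  `|z i - x| <= `|y - x|) /\
    f y - f x = \sum_i (y - x) 0 i * 'D_(delta_mx 0 i) f (z i).
  by apply: plane_MVT => i z /dz[? _]; exact: diff_derivable.
apply: big1 => i _; have [dzi dE] := dz _ (zy i).
rewrite deriveE// dE /dot big1 ?mulr0// => j _; by rewrite mxE mul0r.
Qed.
End gradients.

(** * Continuous selections of smooth functions *)

Section continuous_selection.
Variables (R : realType) (n : nat) (I : finType).
Variables (D : set 'rV[R]_n.+1) (W : 'rV[R]_n.+1 -> R).
Variables (P : I -> 'rV[R]_n.+1 -> R) (dP : I -> 'rV[R]_n.+1 -> 'rV[R]_n.+1).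
Hypothesis oD : open D.
Hypothesis Wcont : forall x, D x -> {for x, continuous W}.
Hypothesis Pgrad : forall i, is_grad D (P i) (dP i).
Hypothesis Wsel : forall x, D x -> exists i, W x = P i x.

Let near_neq i x : D x -> W x <> P i x -> \forall y \near x, W y <> P i y.
Proof.
move=> Dx WP.
have cWP : (fun y => W y - P i y) @ x --> W x - P i x.
  by apply: (@cvgB _ _ _ (nbhs x)); [exact: Wcont|exact: is_grad_continuous Dx].
have WP0 : W x - P i x != 0 by rewrite subr_eq0; exact/eqP.
apply: filterS (cvgr_neq0 _ cWP WP0) => y.
by rewrite subr_eq0 => /eqP.
Qed.

(** Either the first piece agrees with [W] on all of [Q], or they differ at a point, hence on a
    smaller open set, where the rest of the list suffices. *)
Let open_agree (l : seq I) Q : open Q -> Q !=set0 -> Q `<=` D ->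
  (forall x, Q x -> exists2 i, i \in l & W x = P i x) ->
  exists i Q', [/\ open Q', Q' !=set0, Q' `<=` Q &
    forall x, Q' x -> W x = P i x].
Proof.
elim: l Q => [|i l IH] Q oQ [x0 Qx0] QD Ql; first by have [] := Ql _ Qx0.
have [Qi|/existsNP[x /not_implyP[Qx WP]]] :=
    pselect (forall x, Q x -> W x = P i x).
  by exists i, Q; split=> //; exists x0.
have [|||y [Qy /interior_subset /= Wy]|k [Q' [oQ' Q'0 Q'Q WQ']]] :=
    IH (Q `&` [set y | W y <> P i y]^°).
- by apply: openI => //; exact: open_interior.
- by exists x; split=> //; apply: near_neq => //; exact: QD.
- by move=> y [/QD].
- by have [k] := Ql _ Qy; rewrite inE => /predU1P[->//|kl Wk]; exists k.
- exists k, Q'; split=> // y /Q'Q[].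
by [].
Qed.

(* Near x only the pieces J that agree with W on nonempty open sets
   accumulating at x matter; these are all stationary at x. *)
Lemma selection_stationary x :
  (forall i Q, open Q -> Q `<=` D -> (forall y, Q y -> W y = P i y) ->
    forall y, Q y -> dP i y = 0) ->
  D x -> is_diff x W (dot 0).
Proof.
move=> stat Dx.
pose agree i N := exists Q, [/\ open Q, Q !=set0, Q `<=` N `&` D &
  forall y, Q y -> W y = P i y].
pose J i := forall N, nbhs x N -> agree i N.
have JW i : J i -> W x = P i x.
  move=> Ji; apply: contrapT => /(near_neq Dx)/Ji[Q [_ [y Qy] QN WQ]].
  by have [WP _] := QN _ Qy; apply: WP; exact: WQ.
have JdP i : J i -> dP i x = 0.
  move=> Ji; apply/eqP/negPn/negP => dPx.
  have [cdP _] := Pgrad i Dx.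
  have [Q [oQ [y Qy] QN WQ]] := Ji _ (cvgr_neq0 _ (cdP : dP i @ x --> _) dPx).
  have [/eqP dPy _] := QN _ Qy; apply: dPy.
  by apply: (stat i Q) => // z /QN[].
have nearJ : \forall y \near x, exists2 i, J i & W y = P i y.
  (* Each piece outside [J] has a neighbourhood of [x] in which it agrees with [W] on no nonempty
     open set; there are finitely many pieces. *)
  have /choice[N NP] : forall i, exists N, nbhs x N /\ (~ J i -> ~ agree i N).
    move=> i; have [Ji|/existsNP[N /not_implyP[xN nN]]] := pselect (J i).
      by exists setT; split=> //; exact: filterT.
    by exists N.
  have : \forall y \near x, D y /\ forall i, N i y.
    near=> y; split; first by near: y; exact: open_nbhs_nbhs.
    by near: y; apply: filter_forall => i; have [] := NP i.
  move=> /nbhs_interior xO; near=> y.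
  have yO : [set y | D y /\ forall i, N i y]^° y by near: y.
  have [Dy _] := interior_subset yO.
  (* If no piece of [J] took the value of [W] at [y], none would near [y], and [open_agree] would
     supply a piece that is neither in [J] nor outside it. *)
  apply: contrapT => nJ.
  have yneq : \forall z \near y, forall i, J i -> W z <> P i z.
    have Fy : Filter (nbhs y) by exact: nbhs_filter.
    apply: (@filter_forall _ I (fun i z => J i -> W z <> P i z) _ Fy) => i.
    have [Ji|nJi] := pselect (J i); last first.
      by apply: filterE => z /nJi.
    apply: filterS (near_neq Dy (i := i) _); first by move=> z.
    by move=> WP; apply: nJ; exists i.
  have [||||i [Q [oQ [z Qz] QO WQ]]] := @open_agree (enum I)
      ([set y | D y /\ forall i, N i y]^° `&` [set z | forall i,
        J i -> W z <> P i z]^°).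
  - by apply: openI; exact: open_interior.
  - by exists y.
  - by move=> z [/interior_subset[]].
  - move=> z [/interior_subset[/Wsel[i Wi] _] _]; exists i => //.
    by rewrite mem_enum.
  have [Ji|nJi] := pselect (J i).
    have [_ /interior_subset/(_ _ Ji)] := QO _ Qz; apply; exact: WQ.
  have [_ /(_ nJi)] := NP i; apply; exists Q; split=> //; first by exists z.
  by move=> t /QO[/interior_subset[Dt Nt] _].
apply/is_diff_dotP => e e0.
have Pnear : \forall y \near x, forall i,
  J i -> `|P i y - P i x| <= e * `|y - x|.
  apply: (@filter_forall _ I
    (fun i y => J i -> `|P i y - P i x| <= e * `|y - x|) _ (nbhs_filter x)) =>
      i.
  have [Ji|nJi] := pselect (J i); last first.
    by apply: filterE => z /nJi.
  have [_ /is_diff_dotP/(_ e e0)] := Pgrad i Dx.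
  apply: filterS => y; rewrite JdP// => Py _.
  by move: Py; rewrite {1}/dot big1 ?subr0// => k _; rewrite mxE mul0r.
near=> y.
have [i Ji ->] : exists2 i, J i & W y = P i y by near: y.
rewrite (JW _ Ji) {1}/dot big1 ?subr0 => [|k _]; last by rewrite mxE mul0r.
by move: i Ji; near: y.
Unshelve. all: by end_near. Qed.
End continuous_selection.

(** * Smooth graphs *)

Section graph.
Variables (R : realType) (j : 'I_3) (g : 'rV[R]_2 -> R).

(** [unlift j i] is the position of coordinate [i] among those kept by [col' j], which this map
    inverts on the graph. *)
Definition graph_point (s : 'rV[R]_2) : 'rV[R]_3 :=
  \row_i (if unlift j i is Some k then s 0 k else g s).
Local Notation emb := graph_point.

Lemma graph_point_lift s k : emb s 0 (lift j k) = s 0 k.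
Proof. by rewrite mxE liftK. Qed.

Lemma graph_point_height s : emb s 0 j = g s.
Proof. by rewrite mxE unlift_none. Qed.

Lemma col'_graph_point s : col' j (emb s) = s.
Proof. by apply/rowP => k; rewrite mxE graph_point_lift. Qed.

Lemma graph_point_col' (y : 'rV[R]_3) :
  y 0 j = g (col' j y) -> emb (col' j y) = y.
Proof.
move=> yj; apply/rowP => i; rewrite mxE.
by case: unliftP => [k ->|->]; rewrite ?mxE.
Qed.

Lemma sum_lift (F : 'I_3 -> R) : \sum_i F i = F j + \sum_k F (lift j k).
Proof.
rewrite (bigD1 j)//=; congr (_ + _).
rewrite (reindex_omap (lift j) (unlift j))/= => [|i ij].
  by apply: eq_bigl => k; rewrite liftK eqxx andbT eq_sym neq_lift.
by case: unliftP ij => [k ->|->] //; rewrite eqxx.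
Qed.

Lemma norm_col' (y : 'rV[R]_3) : `|col' j y| <= `|y|.
Proof.
rewrite [leLHS]/Num.Def.normr/= mx_normrE; apply: bigmax_le => // -[i k] _ /=.
by rewrite (ord1 i) mxE coord_le_norm.
Qed.

Lemma near_col' (y : 'rV[R]_3) (P : set 'rV[R]_2) :
  (\forall s \near col' j y, P s) -> \forall z \near y, P (col' j z).
Proof.
move=> /nbhs_ballP[r /= r0 rP]; apply/nbhs_ballP; exists r => //= z.
rewrite -ball_normE /= => yz; apply: rP; rewrite -ball_normE /=.
have -> : col' j y - col' j z = col' j (y - z) by apply/rowP => k; rewrite !mxE.
exact: le_lt_trans (norm_col' _) yz.
Qed.

(** * First-order calculus in a chart *)

Section graph_gradient.
Variables (D : set 'rV[R]_2) (dg : 'rV[R]_2 -> 'rV[R]_2).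
Hypothesis oD : open D.
Hypothesis ggrad : is_grad D g dg.

Lemma C1_graph_point i : C1 D (fun s => emb s 0 i).
Proof.
case: (unliftP j i) => [k ->|->].
  by under eq_fun do rewrite graph_point_lift; exact: C1_coord.
by under eq_fun do rewrite graph_point_height; exists dg.
Qed.

Lemma graph_point_lipschitz s : D s ->
  exists2 L, 0 < L & \forall t \near s, enorm (emb t - emb s) <= L * `|t - s|.
Proof.
(* In [K] the 2 compares the Euclidean with the sup norm in the plane and the 1 is the first-order
   remainder; the 3 compares these norms in space. *)
move=> Ds; pose K := enorm (dg s) * 2 + 1.
have K1 : 1 <= K by rewrite lerDr mulr_ge0 ?enorm_ge0.
exists (3 * K); first by rewrite mulr_gt0// (lt_le_trans ltr01).
have [_ /is_diff_dotP/(_ 1 ltr01)] := ggrad Ds; apply: filterS => t;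
  rewrite mul1r => gt.
rewrite (le_trans (enorm_le_norm _))// -mulrA ler_wpM2l//.
have K0 : 0 <= K * `|t - s| by rewrite mulr_ge0// (le_trans _ K1).
rewrite [leLHS]/Num.Def.normr/= mx_normrE; apply: bigmax_le => // -[i k] _ /=.
rewrite (ord1 i) !mxE; case: unliftP => [l _|_].
  have := coord_le_norm (t - s) l; rewrite !mxE => /le_trans; apply.
  by rewrite ler_peMl.
rewrite -(subrK (dot (dg s) (t - s)) (g t - g s)) (le_trans (ler_normD _ _))//.
rewrite /K mulrDl mul1r addrC lerD// (le_trans (dot_le_enorm _ _))//.
by rewrite -mulrA ler_wpM2l ?enorm_ge0// enorm_le_norm.
Qed.

Lemma near_graph_point s (P : set 'rV[R]_3) : D s ->
  (\forall y \near emb s, P y) -> \forall t \near s, P (emb t).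
Proof.
move=> Ds /nbhs_ballP[r /= r0 rP].
have [L L0 sL] := graph_point_lipschitz Ds.
near=> t; apply: rP; rewrite -ball_normE /= distrC.
apply: (le_lt_trans (norm_le_enorm _)).
have /le_lt_trans : enorm (emb t - emb s) <= L * `|t - s| by near: t.
apply; rewrite mulrC -ltr_pdivlMr//.
suff : ball s (r / L) t by rewrite -ball_normE /= distrC.
by near: t; apply: nbhsx_ballx; rewrite divr_gt0.
Unshelve. all: by end_near. Qed.

(* The transpose of the differential of the parametrization. *)
Definition pullback s (G : 'rV[R]_3) : 'rV[R]_2 := col' j G + G 0 j *: dg s.

Lemma pullback_expansion s G e : D s -> 0 < e -> \forall t \near s,
  `|dot G (emb t - emb s) - dot (pullback s G) (t - s)| <= e * `|t - s|.
Proof.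
(* The added 1 keeps [c] positive even if [G] has no component along axis [j]. *)
move=> Ds e0; pose c := `|G 0 j| + 1.
have c0 : 0 < c by rewrite ltr_wpDl.
have [_ /is_diff_dotP/(_ (e / c))] := ggrad Ds; rewrite divr_gt0// => /(_ isT).
apply: filterS => t tg; rewrite /pullback dotDl dotZl.
have -> : dot G (emb t - emb s) = G 0 j * (g t - g s) + dot (col' j G) (t - s).
  rewrite {1}/dot sum_lift !mxE unlift_none; congr (_ + _).
  by apply: eq_bigr => k _; rewrite !mxE liftK.
set X := dot (col' j G) _; set Y := dot (dg s) _ in tg *.
have -> : G 0 j * (g t - g s) + X - (X + G 0 j * Y) = G 0 j * (g t - g s - Y).
  by ring.
rewrite normrM (le_trans (ler_wpM2l (normr_ge0 _) tg))//.
rewrite mulrA ler_wpM2r// mulrCA ler_piMr ?(ltW e0)//.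
by rewrite ler_pdivrMr// mul1r /c lerDl.
Qed.

Lemma is_derive_line n (f : 'rV[R]_n.+1 -> R) x d v :
  is_diff x f (dot d) ->
  is_derive (0 : R) (1 : R) (fun t : R => f (t *: v + x)) (dot d v).
Proof.
move=> [fx dE]; have fv := diff_derivable (v := v) fx.
split; first exact: (derivable1P f x v).1 fv.
rewrite -dE -deriveE// /derive; set q := (X in lim (X @ _) = _).
rewrite (_ : q = fun h => h^-1 *: ((f \o shift x) (h *: v) - f x))//.
by apply/funext => t; rewrite /q /= addr0 scale0r add0r [t%:A]mulr1.
Qed.

(** The witness is the lift to the graph of the line through [s] with direction [v], which stays in
    [D] for small times. *)
Lemma tangent_graph Gamma s (v : 'rV[R]_2) : D s ->
  (forall t, D t -> Gamma (emb t)) ->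
  tangent Gamma (emb s)
    (\row_i (if unlift j i is Some k then v 0 k else dot (dg s) v)).
Proof.
move=> Ds DG; exists (fun t : R => emb (t *: v + s)).
have comp i : is_derive (0 : R) (1 : R) (fun t : R => emb (t *: v + s) 0 i)
    (if unlift j i is Some k then v 0 k else dot (dg s) v).
  case: (unliftP j i) => [k ->|->].
    under eq_fun do rewrite graph_point_lift.
    have [_ dk] := is_grad_coord k Ds.
    by have := is_derive_line v dk; rewrite dot_delta.
  under eq_fun do rewrite graph_point_height.
  by apply: is_derive_line; have [] := ggrad Ds.
have emb' : derivable (fun t : R => emb (t *: v + s)) 0 (1 : R).
  by apply/derivable_mxP => i k; rewrite (ord1 i); apply: ex_derive.
split.
- by rewrite scale0r add0r.
- have : \forall t \near (0 : R), D (t *: v + s).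
    have : (fun t : R => t *: v + s) @ (0 : R) --> 0 *: v + s.
      by apply: (@cvgD _ _ _ (nbhs (0 : R)));
        [exact: scalel_continuous|exact: cvg_cst].
    by apply; rewrite scale0r add0r; exact: open_nbhs_nbhs.
  by apply: filterS => t /DG.
- split=> //; rewrite derive_mx//; apply/rowP => i.
  by rewrite !mxE; exact: derive_val.
Qed.

Section restriction.
Variables (Gamma U : set 'rV[R]_3) (u : 'rV[R]_3 -> R).
Variables (Q : set 'rV[R]_2) (P : 'rV[R]_2 -> R) (dP : 'rV[R]_2 -> 'rV[R]_2).
Hypothesis oU : open U.
Hypothesis oQ : open Q.
Hypothesis QD : Q `<=` D.
Hypothesis GU : Gamma `&` U = [set y | D (col' j y) /\ y 0 j = g (col' j y)].
Hypothesis Pgrad : is_grad D P dP.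
Hypothesis uP : forall s, Q s -> u (emb s) = P s.

Let DGU t : D t -> (Gamma `&` U) (emb t).
Proof. by rewrite GU /= col'_graph_point graph_point_height. Qed.

Lemma surface_grad_exists s : Q s -> exists G,
  is_surface_grad Gamma u (emb s) G.
Proof.
move=> Qs; have Ds := QD Qs.
pose d := dg s; pose q := dP s.
(* For a tangent vector with chart part v, having pullback q means v + (d . v) d = q; this is the
   solution of that rank-one perturbation of the identity. *)
pose v : 'rV[R]_2 := q - (dot d q / (1 + dot d d)) *: d.
pose G : 'rV[R]_3 := \row_i (if unlift j i is Some k then v 0 k else dot d v).
have dd : 1 + dot d d != 0 by rewrite gt_eqF// ltr_pwDl ?dot_ge0.
have pG : pullback s G = q.
  rewrite /pullback; have -> : col' j G = v.
    by apply/rowP => k; rewrite mxE mxE liftK.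
  rewrite mxE unlift_none -/d /v -addrA dotBr dotZr -scaleNr -scalerDl.
  rewrite (_ : - _ + _ = 0) ?scale0r ?addr0//.
  by field.
exists G; split; first by apply: tangent_graph => // t /DGU[].
move=> e e0; have e20 : 0 < e / 2 by rewrite divr_gt0.
have [_ /is_diff_dotP/(_ _ e20) Pexp] := Pgrad Ds.
have Gexp := pullback_expansion G Ds e20.
have Ux : U (emb s) by have [] := DGU Ds.
have near_s : \forall t \near col' j (emb s), Q t /\
    `|P t - P s - dot q (t - s)| <= e / 2 * `|t - s| /\
    `|dot G (emb t - emb s) - dot (pullback s G) (t - s)| <= e / 2 * `|t - s|.
  rewrite col'_graph_point; near=> t; split; first by near: t;
    exact: open_nbhs_nbhs.
  by split; near: t.
rewrite near_withinE; near=> y => Gy.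
have Uy : U y by near: y; exact: open_nbhs_nbhs.
have [Dy yg] : D (col' j y) /\ y 0 j = g (col' j y).
  by have : (Gamma `&` U) y by []; rewrite GU.
have [Qt [Pt Gt]] : Q (col' j y) /\
    `|P (col' j y) - P s - dot q (col' j y - s)| <= e / 2 * `|col' j y - s| /\
    `|dot G (emb (col' j y) - emb s) - dot (pullback s G) (col' j y - s)|
      <= e / 2 * `|col' j y - s|.
  by near: y; exact: (near_col' near_s).
rewrite (graph_point_col' yg) pG in Gt.
have -> : u y = P (col' j y) by rewrite -uP// graph_point_col'.
rewrite uP//; set X := P _ - P _ in Pt *; set Y := dot q _ in Pt Gt.
have -> : X - dot G (y - emb s) = (X - Y) - (dot G (y - emb s) - Y) by ring.
rewrite (le_trans (ler_normB _ _))//.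
(* Deleting a coordinate does not increase the sup norm, so remainders in the chart are bounded by
   distances in space. *)
have ns : `|col' j y - s| <= enorm (y - emb s).
  apply: le_trans (norm_le_enorm _).
  have -> : col' j y - s = col' j (y - emb s).
    by apply/rowP => k; rewrite !mxE liftK.
  exact: norm_col'.
by rewrite (le_trans (lerD Pt Gt))// -mulrDl -splitr ler_wpM2l// (ltW e0).
Unshelve. all: by end_near. Qed.

(** Composed with the parametrization, the expansion of [u] along the surface becomes one of [P]
    with gradient [pullback s G]; differentials are unique. *)
Lemma surface_grad_pullback s G : Q s ->
  is_surface_grad Gamma u (emb s) G -> pullback s G = dP s.
Proof.
move=> Qs [_ uG]; have Ds := QD Qs.
have : is_diff s P (dot (pullback s G)).
  apply/is_diff_dotP => e e0.
  have [L L0 sL] := graph_point_lipschitz Ds.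
  (* Dividing by [L] offsets the Lipschitz constant of the parametrization. *)
  have eL : 0 < e / 2 / L by rewrite !divr_gt0.
  have e20 : 0 < e / 2 by rewrite divr_gt0.
  have Gexp := pullback_expansion G Ds e20.
  have := uG _ eL; rewrite near_withinE => /(near_graph_point Ds) uexp.
  near=> t.
  have Qt : Q t by near: t; exact: open_nbhs_nbhs.
  have ut : `|u (emb t) - u (emb s) - dot G (emb t - emb s)| <=
      e / 2 / L * enorm (emb t - emb s).
    have : Gamma (emb t) by have [] := DGU (QD Qt).
    by near: t.
  rewrite !uP// in ut.
  have Gt : `|dot G (emb t - emb s) - dot (pullback s G) (t - s)| <= e / 2 *
    `|t - s|.
    by near: t.
  set X := dot G _ in ut Gt; set Y := dot _ (t - s) in Gt *.
  have -> : P t - P s - Y = (P t - P s - X) + (X - Y) by ring.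
  rewrite (le_trans (ler_normD _ _))// [e in leRHS](splitr e) mulrDl lerD//.
  rewrite (le_trans ut)// -mulrA ler_wpM2l ?(ltW e20)// ler_pdivrMl//.
  by near: t.
move=> [_ E1]; have [_ [_ E2]] := Pgrad Ds.
apply/rowP => k; have := congr1 (fun f => f (delta_mx 0 k)) (etrans (esym E1)
  E2).
by rewrite !(dotC _ (delta_mx 0 k)) !dot_delta.
Unshelve. all: by end_near. Qed.
End restriction.
End graph_gradient.
End graph.

(** * Surface gradients *)

Section surfaces.
Variable R : realType.
Implicit Types (Gamma : set 'rV[R]_3) (u : 'rV[R]_3 -> R).

(** The graph over a small square around the projection of [p] lies in [O], so [hausdorff2_neq0]
    applies. *)
Lemma hausdorff2_surface_neq0 Gamma (O : set 'rV[R]_3) :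
  locally_smooth_graph Gamma -> open O -> Gamma `&` O !=set0 ->
  hausdorff2 (Gamma `&` O) <> 0%E.
Proof.
move=> Gs oO [p [Gp Op]]; have [j [U [D [g [oU Up oD smg GU]]]]] := Gs p Gp.
have [dg ggrad] := Cn1_C1 oD (smg 1%N).
have [Dp pg] : D (col' j p) /\ p 0 j = g (col' j p).
  by have : (Gamma `&` U) p by []; rewrite GU.
pose s := col' j p; have ps := graph_point_col' pg.
have : \forall t \near s, D t /\ O (graph_point j g t).
  near=> t; split; first by near: t; exact: open_nbhs_nbhs.
  near: t; apply: (near_graph_point ggrad) => //.
  by rewrite ps; exact: open_nbhs_nbhs.
move=> /nbhs_ballP[r /= r0 rP].
(* The two coordinates are those other than [j]; half the radius keeps the closed square inside the
   open ball. *)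
apply: (@hausdorff2_neq0 _ (lift j ord0) (lift j ord_max) _
  (s 0 ord0) (s 0 ord_max) (r / 2)); first by rewrite divr_gt0.
move=> a b ra rb; pose t : 'rV[R]_2 :=
  b *: delta_mx 0 ord_max + a *: delta_mx 0 ord0.
have ta : t 0 ord0 = a by rewrite !mxE /= mulr0 mulr1 add0r.
have tb : t 0 ord_max = b by rewrite !mxE /= mulr0 mulr1 addr0.
have [Dt Ot] : D t /\ O (graph_point j g t).
  apply: rP; rewrite -ball_normE /= distrC.
  apply: (@le_lt_trans _ _ (r / 2));
    last by rewrite ltr_pdivrMr// mulr_natr mulr2n ltrDl.
  rewrite (row2E (t - s)); apply: norm_row2_le; rewrite ?divr_ge0 ?(ltW r0)//.
    by rewrite mxE tb mxE.
  by rewrite mxE ta mxE.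
exists (graph_point j g t); split; last 2 first.
- by rewrite graph_point_lift.
- by rewrite graph_point_lift.
split=> //; have : (Gamma `&` U) (graph_point j g t); last by case.
by rewrite GU /= col'_graph_point graph_point_height.
Unshelve. all: by end_near. Qed.

(** Along a curve with velocity [G], the products of [G] with the difference quotients tend to the
    squared length of [G], and the hypothesis makes them arbitrarily small. *)
Lemma tangent_orthogonal_eq0 Gamma x (G : 'rV[R]_3) : tangent Gamma x G ->
  (forall e, 0 < e -> \forall y \near within Gamma (nbhs x),
    `|dot G (y - x)| <= e * enorm (y - x)) -> G = 0.
Proof.
move=> [gamma [gx Ggamma [dgamma gammaE]]] Gsmall.
pose q h := h^-1 *: (gamma h - x).
have qG : q h @[h --> (0 : R)^'] --> G.
  rewrite -gammaE /derive; move: dgamma; rewrite /derivable => dgamma.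
  rewrite (_ : q = fun h => h^-1 *: ((gamma \o shift 0) (h *: (1 :
    R)) - gamma 0))//.
  by apply/funext => h; rewrite /q /= addr0 [h%:A]mulr1 gx.
have gammax : gamma h @[h --> (0 : R)] --> x.
  rewrite -gx; apply: differentiable_continuous.
  exact/derivable1_diffP.
suff GG : dot G G = 0.
  apply/rowP => i; rewrite mxE; apply/eqP; rewrite -normr_le0.
  by rewrite (le_trans (coord_le_enorm G i))// /enorm GG sqrtr0.
(* [c] bounds the Euclidean length of the difference quotients for small [h]: their sup norm is
   eventually at most |G| + 1, and 3 passes to the Euclidean norm. *)
pose c := 3 * (`|G| + 1).
have c0 : 0 < c by rewrite mulr_gt0// ltr_wpDl.
suff GGe e : 0 < e -> dot G G <= e * c.
  apply/eqP; rewrite eq_le dot_ge0 andbT; apply/ler_addgt0Pr => e e0.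
  by rewrite add0r (le_trans (GGe (e / c) _)) ?divr_gt0// divfK ?gt_eqF.
move=> e0.
have cq : dot G (q h) @[h --> (0 : R)^'] --> dot G G.
  exact: (cvg_comp _ _ qG (@continuous_dot _ _ G G)).
apply: (cvgr_to_le cq).
have near0 : \forall h \near (0 : R), Gamma (gamma h) /\
    `|dot G (gamma h - x)| <= e * enorm (gamma h - x).
  have xe : \forall h \near (0 : R), Gamma (gamma h) ->
      `|dot G (gamma h - x)| <= e * enorm (gamma h - x).
    by have := Gsmall e e0; rewrite near_withinE => /gammax.
  near=> h; have Gh : Gamma (gamma h) by near: h.
  by split=> //; move: Gh; near: h.
near=> h.
have h0 : h != 0 by near: h; exact: nbhs_dnbhs_neq.
have [_ he] : Gamma (gamma h) /\ `|dot G (gamma h - x)| <= e * enorm (gamma h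
  - x).
  by near: h; exact: nbhs_dnbhs.
have qh : `|q h| <= `|G| + 1.
  by near: h; apply: (cvgr_norm_le _ qG); rewrite ltrDl.
have eq : enorm (q h) <= c.
  by rewrite (le_trans (enorm_le_norm _))// ler_wpM2l.
apply: (@le_trans _ _ (e * enorm (q h))); last by rewrite ler_wpM2l// ltW.
rewrite (le_trans (ler_norm _))// /q dotZr normrM enormZ mulrCA ler_wpM2l//.
Unshelve. all: by end_near. Qed.

(** Where no surface gradient exists, the default value is 0; where one exists, tangency forces it
    to vanish. *)
Lemma surface_grad_cst Gamma u c x :
  (forall y, Gamma y -> u y = c) -> Gamma x -> surface_grad Gamma u x = 0.
Proof.
move=> uc Gx; rewrite /surface_grad; case: xgetP => // G _ [tG Gu].
apply: (tangent_orthogonal_eq0 tG) => e e0; have := Gu e e0.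
rewrite !near_withinE; apply: filterS => y /[swap] Gy /(_ Gy).
by rewrite !uc// subrr sub0r normrN.
Qed.

Lemma dirichlet_form_cst Gamma u v c :
  (forall y, Gamma y -> u y = c) -> dirichlet_form Gamma u v = 0%E.
Proof.
move=> uc; apply: integral0_eq => x Gx.
rewrite (surface_grad_cst uc Gx) /dot big1// => i _; by rewrite mxE mul0r.
Qed.

(** The gradient of the piece stays nonzero nearby, and as it is the pullback of the surface
    gradient, the latter stays away from 0 on a closed set of positive area. *)
Lemma dirichlet_form_neq0 Gamma u (j : 'I_3) (U : set 'rV[R]_3)
    (D Q : set 'rV[R]_2) g dg P dP s :
  locally_smooth_graph Gamma -> closed Gamma ->
  open U -> open D -> is_grad D g dg ->
  Gamma `&` U = [set y | D (col' j y) /\ y 0 j = g (col' j y)] ->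
  open Q -> Q `<=` D -> is_grad D P dP ->
  (forall t, Q t -> u (graph_point j g t) = P t) ->
  Q s -> dP s <> 0 -> dirichlet_form Gamma u u <> 0%E.
Proof.
move=> smG cG oU oD ggrad GU oQ QD Pgrad uP Qs dPs; have Ds := QD _ Qs.
have [k dPk] : exists k, dP s 0 k != 0.
  apply: contrapT => /forallNP H; apply: dPs; apply/rowP => k.
  by rewrite mxE; apply/eqP/negPn/negP; exact: H.
pose d := `|dP s 0 k|; have d0 : 0 < d by rewrite normr_gt0.
pose M := `|dg s 0 k| + 1; have M0 : 0 < M by rewrite ltr_wpDl.
pose x := graph_point j g s.
have [Gx Ux] : (Gamma `&` U) x.
  by rewrite GU /= col'_graph_point graph_point_height.
have near_coord (f : 'rV[R]_2 -> 'rV[R]_2) : {for s, continuous f} ->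
    f t 0 k @[t --> s] --> f s 0 k.
  move=> fs; exact: (cvg_comp _ _ fs (@coord_continuous _ _ _ 0 k (f s))).
have : \forall y \near x, U y /\ [/\ Q (col' j y),
  d / 2 <= `|dP (col' j y) 0 k| &
    `|dg (col' j y) 0 k| <= M].
  near=> y; split; first by near: y; exact: open_nbhs_nbhs.
  near: y; apply: (@near_col' _ j x (fun t => [/\ Q t, d / 2 <= `|dP t 0 k| &
    `|dg t 0 k| <= M])).
  rewrite col'_graph_point; near=> t; split.
  - by near: t; exact: open_nbhs_nbhs.
  - near: t; have [cdP _] := Pgrad s Ds.
    apply: (cvgr_norm_ge _ (near_coord _ cdP)).
    by rewrite ltr_pdivrMr// mulr_natr mulr2n ltrDl.
  - near: t; have [cdg _] := ggrad s Ds.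
    by apply: (cvgr_norm_le _ (near_coord _ cdg)); rewrite ltrDl.
move=> /nbhs_ballP[r /= r0 rP].
(* The k-th component of the pullback is at least d/2 in absolute value and at most 1 + M times the
   length of the surface gradient. *)
pose c := (d / 2) / (1 + M).
have M1 : 0 < 1 + M by rewrite addr_gt0.
have c0 : 0 < c by rewrite !divr_gt0.
have r20 : 0 < r / 2 by rewrite divr_gt0.
(* The closed ball makes [B] closed, hence measurable; the open ball inside gives it positive
   area. *)
pose B := Gamma `&` closed_ball x (r / 2).
have closB : closed B by apply: closedI => //; exact: closed_ball_closed.
apply: (@area_integral_neq0 _ B _ _ (c ^+ 2)) => //.
- by move=> y [].
- move=> B0; have : hausdorff2 (Gamma `&` ball x (r / 2)) <> 0%E.
    apply: hausdorff2_surface_neq0 => //; first exact: ball_open.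
    by exists x; split=> //; exact: ballxx.
  apply; apply/eqP; rewrite eq_le hausdorff2_ge0 andbT -B0.
  by apply: le_hausdorff2; apply: setIS; exact: subset_closed_ball.
- by rewrite exprn_gt0.
- by move=> y _; exact: dot_ge0.
- move=> y [Gy ry].
  have [Uy [Qy dPy dgy]] : U y /\ [/\ Q (col' j y),
    d / 2 <= `|dP (col' j y) 0 k| &
      `|dg (col' j y) 0 k| <= M].
    apply: rP; apply: subset_closure_half ry; exact: r0.
  have [Dy yg] : D (col' j y) /\ y 0 j = g (col' j y).
    by have : (Gamma `&` U) y by []; rewrite GU.
  have ye := graph_point_col' yg.
  have [G GG] := surface_grad_exists oD ggrad oU oQ QD GU Pgrad uP Qy.
  rewrite ye in GG.
  (* Since a surface gradient exists at [y], the chosen value is one and not the default. *)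
  have : is_surface_grad Gamma u y (surface_grad Gamma u y).
    by rewrite /surface_grad; exact: (xgetPex 0 (ex_intro _ G GG)).
  move: (surface_grad _ _ _) => H; rewrite -{1}ye => HH.
  have := surface_grad_pullback ggrad oQ QD GU Pgrad uP Qy HH.
  move=> /(congr1 (fun v : 'rV_2 => v 0 k)); rewrite !mxE => E.
  rewrite -E in dPy.
  have cH : c <= enorm H.
    rewrite ler_pdivrMr// (le_trans dPy)// (le_trans (ler_normD _ _))//.
    rewrite mulrDr mulr1 lerD ?coord_le_enorm// normrM.
    by rewrite ler_pM// coord_le_enorm.
  rewrite -[leRHS]sqr_sqrtr ?dot_ge0// lerXn2r ?nnegrE ?enorm_ge0//.
  exact: ltW.
Unshelve. all: by end_near. Qed.
End surfaces.

(** * Finite element spaces *)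

Section finite_elements.
Variable R : realType.
Implicit Types (Gamma : set 'rV[R]_3).

Lemma C1_poly3 j (g : 'rV[R]_2 -> R) D dg k
    (c : {ffun 'I_3 -> 'I_k.+1} -> R) :
  is_grad D g dg -> C1 D (fun s => poly3 c (graph_point j g s)).
Proof.
move=> ggrad; apply: C1_sum => m; apply: C1M; first exact: C1_cst.
by apply: C1_prod => i; apply: C1X; exact: (C1_graph_point j ggrad).
Qed.

(** The level set of [f] through [x] is open and closed in [A]. *)
Lemma connected_locally_constant (T : topologicalType) (X : Type)
    (A : set T) (f : T -> X) :
  connected A -> (forall x, A x -> \forall y \near x, A y -> f y = f x) ->
  forall x y, A x -> A y -> f y = f x.
Proof.
move=> cA floc x y Ax Ay; pose B := [set z | A z /\ f z = f x].
have : B = A.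
  apply: cA; first by exists x.
  - exists [set z | A z -> f z = f x]^°; first exact: open_interior.
    apply/seteqP; split=> [z [Az fz]|z [Az /interior_subset/(_ Az)]];
      split=> //.
    by apply: filterS (floc z Az) => t ft /ft; rewrite fz.
  - exists (~` [set z | A z -> f z <> f x]^°).
      by apply: open_closedC; exact: open_interior.
    apply/seteqP; split=> [z [Az fz]|z [Az nz]]; split=> //.
      by move=> /interior_subset/(_ Az).
    apply: contrapT => fz; apply: nz.
    by apply: filterS (floc z Az) => t ft /ft ->.
by move=> /seteqP[_ /(_ _ Ay)[]].
Qed.

Lemma dirichlet_form_eq0 Gamma (O : set 'rV[R]_3) (w : 'rV[R]_3 -> R)
    (I : finType) k (c : I -> {ffun 'I_3 -> 'I_k.+1} -> R) :
  closed_smooth_surface Gamma -> Gamma `<=` O -> {within O, continuous w} ->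
  (forall y, Gamma y -> exists i, w y = poly3 (c i) y) ->
  dirichlet_form Gamma w w = 0%E ->
  forall x y, Gamma x -> Gamma y -> w y = w x.
Proof.
move=> [_ cptG conG smG] GO /subspace_continuousP wcont wsel w0.
have cG : closed Gamma by apply: compact_closed => //; exact: norm_hausdorff.
apply: connected_locally_constant => // p Gp.
have [j [U [D [g [oU Up oD smg GU]]]]] := smG p Gp.
have [dg ggrad] := Cn1_C1 oD (smg 1%N).
have [Dp pg] : D (col' j p) /\ p 0 j = g (col' j p).
  by have : (Gamma `&` U) p by []; rewrite GU.
pose s := col' j p; have ps := graph_point_col' pg.
pose emb := graph_point j g.
have DG t : D t -> Gamma (emb t).
  move=> Dt; have : (Gamma `&` U) (emb t); last by case.
  by rewrite GU /= col'_graph_point graph_point_height.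
have /choice[dP Pgrad] i : exists df,
  is_grad D (fun t => poly3 (c i) (emb t)) df.
  exact: C1_poly3 ggrad.
have stat t : D t -> is_diff t (w \o emb) (dot 0).
  apply: (selection_stationary oD _ Pgrad).
  - move=> {}t Dt V wV.
    (* The chart maps [D] into [O], so continuity within [O] makes the composite continuous on
       [D]. *)
    have /(near_graph_point ggrad Dt) OV :
      \forall y \near emb t, O y -> V (w y).
      exact: (wcont (emb t) (GO _ (DG _ Dt)) V wV).
    suff : \forall r \near t, V (w (emb r)) by [].
    near=> r.
    have Dr : D r by near: r; exact: open_nbhs_nbhs.
    have : O (emb r) -> V (w (emb r)) by near: r.
    by apply; exact/GO/DG.
  - by move=> {}t Dt; have [i] := wsel _ (DG _ Dt); exists i.
  (* A nonzero gradient of a piece that agrees with [w] on an open set would contradict the zero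
     energy. *)
  - move=> i Q oQ QD wP r Qr; apply: contrapT => dPr.
    exact: (dirichlet_form_neq0 smG cG oU oD ggrad GU oQ QD (Pgrad i) wP Qr
      dPr).
have /nbhs_ballP[r /= r0 rD] : nbhs s D by exact: open_nbhs_nbhs.
have Wcst t : `|t - s| < r -> w (emb t) = w p.
  move=> ts; rewrite -ps; apply: (locally_constant (f := w \o emb) (r :=
    r)) => // q qs.
  by apply: stat; apply: rD; rewrite -ball_normE /= distrC.
near=> y => Gy.
have Uy : U y by near: y; exact: open_nbhs_nbhs.
have [Dy yg] : D (col' j y) /\ y 0 j = g (col' j y).
  by have : (Gamma `&` U) y by []; rewrite GU.
rewrite -(graph_point_col' yg); apply: Wcst.
have : ball s r (col' j y) by near: y; apply: near_col'; exact: nbhsx_ballx.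
by rewrite -ball_normE /= distrC.
Unshelve. all: by end_near. Qed.

(** * Covering of the surface by the active tetrahedra *)

Lemma compact_tetra (P : 'M[R]_(4, 3)) : compact (tetra P).
Proof.
(* Nonnegative weights of sum 1 are at most 1, so they fill the part of a compact cube on a
   hyperplane. *)
pose K := [set a : 'rV[R]_4 | forall i, `[0, 1]%classic (a ord0 i)] `&`
  [set a | dot (const_mx 1) a = 1].
have -> : tetra P = (fun a => a *m P) @` K.
  have sumE (a : 'rV[R]_4) : dot (const_mx 1) a = \sum_l a 0 l.
    by apply: eq_bigr => i _; rewrite mxE mul1r.
  apply/seteqP; split=> [x [a [a0 _ a1 ->]]|_ [a [a01 a1] <-]].
    exists a => //; split; last by rewrite /= sumE.
    move=> i /=; rewrite in_itv/= a0 -a1 (bigD1 i)//= lerDl.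
    by apply: sumr_ge0 => l _.
  exists a; split=> // [l|l /(_ I)//|]; last by rewrite -sumE.
  by have := a01 l; rewrite /= in_itv/= => /andP[].
have cf : continuous (fun a : 'rV[R]_4 => a *m P).
  move=> u; apply/(@cvgrPdist_le _ _ _ (nbhs u)) => e e0.
  near=> b; rewrite [leLHS]/Num.Def.normr/= mx_normrE.
  apply: bigmax_le => [|[i l] _ /=]; first exact: ltW.
  rewrite (ord1 i) {i}; move: l; near: b; apply: filter_forall => l.
  have : dot (\row_i P i l) b @[b --> u] --> dot (\row_i P i l) u.
    exact: continuous_dot.
  move/cvgrPdist_le => /(_ e e0); apply: filterS => b.
  have E (v : 'rV[R]_4) : (v *m P) 0 l = dot (\row_i P i l) v.
    by rewrite mxE; apply: eq_bigr => i _; rewrite mxE mulrC.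
  by rewrite -!E !mxE.
have cI : compact [set a : 'rV[R]_4 | forall i, `[0, 1]%classic (a ord0 i)].
  exact: (@rV_compact _ _ (fun=> `[0 :
    R, 1]%classic) (fun=> @segment_compact R 0 1)).
have cK : compact K.
  apply: (subclosed_compact _ cI); last by move=> a [].
  apply: closedI; first exact: compact_closed (@norm_hausdorff _ _) cI.
  apply: (@preimage_closed _ _ (dot (const_mx 1)) [set x : R | x = 1]);
    last exact: closed_eq.
  by move=> a _; exact: continuous_dot.
exact: continuous_compact (continuous_subspaceT cf) cK.
Unshelve. all: by end_near. Qed.

(** The uncovered part of the surface is relatively open, so it has positive area unless empty, yet
    it is a finite union of null sets. *)
Lemma surface_sub_active_domain (Omega Gamma : set 'rV[R]_3) (kappa : R)
    (I : finType) (V : I -> 'M[R]_(4, 3)) (A : set I) :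
  closed_smooth_surface Gamma -> Gamma `<=` Omega ->
  tetra_partition Omega kappa V -> active_selection Gamma V A ->
  Gamma `<=` active_domain V A.
Proof.
move=> [_ _ _ smG] GOmega part sel x Gx; apply: contrapT => nx.
have oO : open (~` active_domain V A).
  apply: closed_openC; apply: closed_bigcup => [|i _];
    first exact: finite_finset.
  exact: compact_closed (@norm_hausdorff _ _) (@compact_tetra _).
apply: (hausdorff2_surface_neq0 smG oO); first by exists x.
pose N i := Defs.cut Gamma V i `&` ~` active_domain V A.
(* An uncovered point lies only in dropped tetrahedra: their cuts have zero area or lie in a kept
   neighbour, which would cover the point. *)
have N0 i : hausdorff2 (N i) = 0%E.
  have [->|/set0P[y [[Ty Gy] ny]]] := eqVneq (N i) set0;
    first exact: hausdorff2_set0.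
  have nAi : ~ A i by move=> Ai; apply: ny; exists i.
  apply/eqP; rewrite eq_le hausdorff2_ge0 andbT.
  apply: (@le_trans _ _ (hausdorff2 (Defs.cut Gamma V i))).
    by apply: le_hausdorff2 => z [].
  have [->//|ci0] := eqVneq (hausdorff2 (Defs.cut Gamma V i)) 0%E.
  have [k Ak [_ ik]] := active_dropped sel nAi (elimN eqP ci0).
  have [_ Tk] : (tetra (V i) `&` tetra (V k)) y by apply: ik.
  by exfalso; apply: ny; exists k.
(* The finite family is listed as a sequence, padded with empty sets, for countable
   subadditivity. *)
pose F n := if unpickle n is Some i then N i else set0.
apply/eqP; rewrite eq_le hausdorff2_ge0 andbT.
apply: (@le_trans _ _ (hausdorff2 (\bigcup_n F n))).
  apply: le_hausdorff2 => y [Gy ny].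
  have : closure Omega y by apply: subset_closure; exact: GOmega.
  rewrite -(partition_cover part) => -[i _ Ty].
  by exists (pickle i) => //; rewrite /F pickleK.
apply: (le_trans (hausdorff2_sigma_subadditive _)).
rewrite eseries0// => n _ _; rewrite /F; case: unpickle => [i|];
  first exact: N0.
exact: hausdorff2_set0.
Qed.

(** * Linear structure and finite dimension of the finite element space *)

Section fe_space.
Variables (I : finType) (V : I -> 'M[R]_(4, 3)) (A : set I) (k : nat).
Local Notation omega := (active_domain V A).
Local Notation W := (fe_space V A k).

Lemma fe_space_lin_closed : lin_closed W.
Proof.
move=> n b c Wb; split.
- have addc : continuous (fun z : R * R => z.1 + z.2) by exact: add_continuous.
  apply: (continuous_big addc) => i _ x.
  by apply: cvgM; [exact: cvg_cst|have [cb _ _] := Wb i; exact: cb].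
- move=> a Aa; have /choice[C bC] : forall i, exists C :
  {ffun 'I_3 -> 'I_k.+1} -> R,
      forall x, tetra (V a) x -> b i x = poly3 C x.
    by move=> i; have [_ /(_ a Aa)] := Wb i.
  exists (fun m => \sum_i c i * C i m) => x Vx.
  under eq_bigr => i _ do rewrite (bC i x Vx) /poly3 mulr_sumr.
  rewrite exchange_big /=; apply: eq_bigr => m _; rewrite mulr_suml.
  by apply: eq_bigr => i _; rewrite mulrA.
- move=> x nx; apply: big1 => i _; have [_ _ /(_ x nx) ->] := Wb i.
  by rewrite mulr0.
Qed.

Lemma fe_space_cst (c : R) : W (fun x => c * fe_one V A x).
Proof.
have W1 : W (fe_one V A).
  split.
  - apply/subspace_continuousP => x ox B /nbhs_singleton Bx.
    have oneE y : omega y -> fe_one V A y = 1.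
      by move=> oy; rewrite /fe_one indicE mem_set.
    have B1 : B 1 by rewrite -(oneE x ox).
    suff : \forall y \near x, omega y -> B (fe_one V A y) by [].
    by apply: filterE => y /oneE ->.
  (* The constant 1 has the single coefficient 1, at the zero exponents. *)
  - move=> i Ai; exists (fun m => (m == [ffun=> ord0])%:R) => x Vx.
    rewrite /fe_one indicE mem_set; last by exists i.
    rewrite /poly3 (bigD1 [ffun=> ord0])/=; last first.
      by rewrite big1// => j _; rewrite ffunE.
    rewrite eqxx mul1r big1 => [|j _]; last by rewrite ffunE expr0.
    rewrite big1 ?addr0// => m /andP[_ /negPf ->]; exact: mul0r.
  - by move=> x nx; rewrite /fe_one indicE memNset.
have := @fe_space_lin_closed 1 (fun=> fe_one V A) (fun=> c) (fun=> W1).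
by rewrite (_ : (fun _ => _) = fun x => c * fe_one V A x)//;
  apply/funext => x; rewrite big_ord1.
Qed.

(** Monomials cut off to single tetrahedra span the space; they need not be continuous, but a finite
    spanning family of any functions bounds the dimension. *)
Lemma fe_space_has_dim : exists n, has_dim W n.
Proof.
(* One active tetrahedron is picked per point, so that points of shared faces are counted once. *)
pose sel x := [pick i | `[< A i /\ tetra (V i) x >]].
pose f (p : I * {ffun 'I_3 -> 'I_k.+1}) (x : 'rV[R]_3) : R :=
  if (sel x == Some p.1) && (\sum_j p.2 j <= k)%N
  then \prod_j x 0 j ^+ p.2 j else 0.
apply: (lin_closed_has_dim (f := f)) fe_space_lin_closed _ => v [_ vP v0].
have /choice[C vC] : forall i, exists C : {ffun 'I_3 -> 'I_k.+1} -> R,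
    A i -> forall x, tetra (V i) x -> v x = poly3 C x.
  move=> i; have [Ai|nAi] := pselect (A i); last by exists (fun=> 0).
  by have [C vC] := vP i Ai; exists C.
exists (fun p => C p.1 p.2) => x.
rewrite -(pair_bigA _ (fun i m => C i m * f (i, m) x))/=.
rewrite /f /=; case Es : (sel x) => [i|]; last first.
  rewrite v0.
    by rewrite big1// => i _; rewrite big1// => m _; rewrite mulr0.
  move: Es; rewrite /sel; case: pickP => // nsel _ [i Ai Vx].
  by have /asboolP := nsel i; case.
have [Ai Vx] : A i /\ tetra (V i) x.
  by move: Es; rewrite /sel; case: pickP => // l /asboolP Al [<-].
rewrite (vC i Ai x Vx) (bigD1 i)//= [X in _ = _ + X]big1 ?addr0; last first.
  move=> l li; rewrite big1// => m _; rewrite (_ : _ == _ = false) ?mulr0//.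
  by apply/eqP => -[il]; rewrite il eqxx in li.
rewrite /poly3 big_mkcond; apply: eq_bigr => m _.
by rewrite eqxx/=; case: ifP; rewrite ?mulr0.
Qed.
End fe_space.
End finite_elements.

(** * The four conditions in a cycle of implications *)

Theorem lemma3p1 (R : realType) (Omega Gamma : set 'rV[R]_3) (kappa : R)
    (I : finType) (V : I -> 'M[R]_(4, 3)) (A : set I) (k : nat) :
  bounded_domain Omega ->
  closed_smooth_surface Gamma ->
  Gamma `<=` Omega ->
  tetra_partition Omega kappa V ->
  active_selection Gamma V A ->
  (1 <= k)%N ->
  [<-> Ker_h V A k Gamma = span1 (fe_one V A);
       E0 V A k Gamma = [set (fun=> 0)];
       forall w, fe_space V A k w -> w <> (fun=> 0) ->
         ~ (Gamma `<=` zero_level V A w);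
       exists n, has_dim (fe_space V A k) n /\
                 has_dim (trace_space V A k Gamma) n].
Proof.
move=> _ surf GOmega part sel _.
have Gomega := surface_sub_active_domain surf GOmega part sel.
have Wlin := @fe_space_lin_closed R I V A k.
have one y : Gamma y -> fe_one V A y = 1.
  by move=> Gy; rewrite /fe_one indicE mem_set//; exact: Gomega.
have trace0 v : trace Gamma v = (fun=> 0) <-> forall y, Gamma y -> v y = 0.
  split=> [v0 y Gy|v0].
    by have := congr1 (@^~ y) v0; rewrite /= traceE mem_set.
  by apply/funext => y; rewrite traceE; case: ifPn => // /set_mem /v0.
have [p Gp] := surface_nonempty surf.
tfae.
- move=> KerE; apply/seteqP; split=> [v [Wv v0]|_ ->] /=; last first.
    split; last by apply/trace0.
    have := @fe_space_cst R I V A k 0.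
    by under eq_fun do rewrite mul0r.
  have /trace0 vG := v0.
  (* Vanishing on the surface, [v] is in the kernel, hence a multiple of 1; its value at [p] shows
     that the factor is 0. *)
  have : Ker_h V A k Gamma v.
    by split=> // u _; exact: dirichlet_form_cst vG.
  rewrite KerE => -[c _ vE]; have := vG p Gp; rewrite -vE one// mulr1 => c0.
  by apply/funext => x; rewrite c0 mul0r.
- move=> E0E w Ww w0 Gw; apply: w0.
  suff : E0 V A k Gamma w by rewrite E0E.
  by split=> //; apply/trace0 => y /Gw[].
- move=> noker; have [n Wn] := @fe_space_has_dim R I V A k.
  (* Equal dimensions mean that the trace is injective. *)
  exists n; split=> //; apply/(has_dim_restrict Gamma Wlin Wn) => v Wv /trace0
    vG.
  apply: contrapT => v0; apply: (noker v Wv v0) => y Gy.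
  by split; [exact: Gomega|exact: vG].
- move=> [n [Wn /(has_dim_restrict Gamma Wlin Wn) inj]].
  apply/seteqP; split=> [w [Ww wker]|_ [c _ <-]].
    have [wcont wP w0] := Ww.
    have /choice[C wC] : forall i, exists C : {ffun 'I_3 -> 'I_k.+1} -> R,
        A i -> forall x, tetra (V i) x -> w x = poly3 C x.
      move=> i; have [Ai|nAi] := pselect (A i); last by exists (fun=> 0).
      by have [C wC] := wP i Ai; exists C.
    have wG : forall x y, Gamma x -> Gamma y -> w y = w x.
      apply: (dirichlet_form_eq0 surf Gomega wcont (c := C)); last exact: wker.
      by move=> y /Gomega[i Ai Vy]; exists i; exact: wC.
    exists (w p) => //; apply/esym/funext => x.
    (* The difference of [w] and the constant [w p] is put as a combination of two functions to fit
       [lin_closed]; its trace vanishes, so injectivity makes it zero. *)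
    pose u (i : 'I_2) := if i == ord0 then w else fun x => w p * fe_one V A x.
    pose c (i : 'I_2) : R := if i == ord0 then 1 else -1.
    have uE y : \sum_i c i * u i y = w y - w p * fe_one V A y.
      by rewrite big_ord_recl big_ord1 /c /u /= mul1r mulN1r.
    have Wu i : fe_space V A k (u i).
      by rewrite /u; case: ifP => _ //; exact: fe_space_cst.
    have W0 : (fun y => w y - w p * fe_one V A y) = (fun=> 0).
      apply: inj; first by rewrite -(funext uE); exact: Wlin.
      by apply/trace0 => y Gy; rewrite (wG p)// one// mulr1 subrr.
    by have /subr0_eq := congr1 (@^~ x) W0.
  split; first exact: fe_space_cst.
  move=> v _; apply: (@dirichlet_form_cst _ _ _ _ c) => y Gy.
  by rewrite one// mulr1.
Qed.
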